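(* Let $\Omega\subset\mathbb{R}^{2d}$ be a measurable subset of finite Lebesgue measure, and let $S$ be a positive trace class operator on $L^2(\mathbb{R}^d)$ with $\mathrm{tr}(S)=1$. Then (1) $\mathrm{tr}(\chi_\Omega\star S)=\mu(\Omega)$, where $\mu$ is Lebesgue measure. (2) If $\{\lambda_i\}_{i=1}^N$ ($N\in\mathbb{N}\cup\{\infty\}$) are the eigenvalues of $\chi_\Omega\star S$ counted with algebraic multiplicity, then $\sum_{i=1}^N\lambda_i=\mu(\Omega)$.
   Context: For $z=(x,\omega)\in\mathbb{R}^{2d}$, $\pi(z)\psi(t)=e^{2\pi i\omega\cdot t}\psi(t-x)$ on $L^2(\mathbb{R}^d)$ and $\alpha_z(A)=\pi(z)A\pi(z)^*$. For $f\in L^1(\mathbb{R}^{2d})$ and $S$ trace class, $f\star S$ is the trace class operator defined weakly by $f\star S=\iint_{\mathbb{R}^{2d}}f(z)\alpha_z(S)\,dz$, i.e. $\langle(f\star S)\psi,\phi\rangle=\iint f(z)\langle\alpha_z(S)\psi,\phi\rangle\,dz$. $\chi_\Omega$ is the characteristic function of $\Omega$. An operator $S$ is positive if $\langle S\psi,\psi\rangle\ge0$ for all $\psi\in L^2(\mathbb{R}^d)$. *)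

(* Defs.v *)
From HB Require Import structures.
From mathcomp Require Import all_boot all_order all_algebra.
From mathcomp Require Import all_classical all_reals all_analysis.
From mathcomp Require Import complex.

Set Implicit Arguments.
Unset Strict Implicit.
Unset Printing Implicit Defensive.
Import Order.TTheory GRing.Theory Num.Theory.
Import numFieldNormedType.Exports.

Local Open Scope classical_set_scope.
Local Open Scope ring_scope.
Local Open Scope complex_scope.
Local Open Scope quotient_scope.

(** Lebesgue measure on R^n: the n-fold product of [lebesgue_measure], on the Borel sigma-algebra of
    [Rn R n]: [lebesgue_n n.+1] is the product of the measure on R and of
    [lebesgue_n n], carried along [(a, t) |-> a :: t]. *)

Notation Rn R n := (n.-tuple (measurableTypeR R)).

Section tuple_measure_cons.
Context d (T : measurableType d) {R : realType} (n : nat).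
Variable m1 : {sigma_finite_measure set T -> \bar R}.
Variable m : {sigma_finite_measure set (n.-tuple T) -> \bar R}.

Definition tcons (p : T * n.-tuple T) : n.+1.-tuple T :=
  [tuple of p.1 :: p.2].

Lemma measurable_tcons : measurable_fun [set: T * n.-tuple T] tcons.
Proof. exact: measurable_cons. Qed.

Definition tuple_measure_cons : set (n.+1.-tuple T) -> \bar R :=
  pushforward (m1 \x m)%E tcons.

Let tuple_measure_cons0 : tuple_measure_cons set0 = 0%E.
Proof. by rewrite /tuple_measure_cons /pushforward preimage_set0 measure0. Qed.

Let tuple_measure_cons_ge0 A : (0 <= tuple_measure_cons A)%E.
Proof. by rewrite /tuple_measure_cons /pushforward measure_ge0. Qed.

Let tuple_measure_cons_sigma_additive : semi_sigma_additive tuple_measure_cons.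
Proof.
move=> F mF tF mUF; rewrite /tuple_measure_cons /pushforward preimage_bigcup.
apply: measure_semi_sigma_additive.
- by move=> k; rewrite -[X in measurable X]setTI; exact: measurable_tcons.
- apply/trivIsetP => /= i j _ _ ij; rewrite -preimage_setI.
  by move/trivIsetP : tF => /(_ _ _ _ _ ij) ->//; rewrite preimage_set0.
- by rewrite -preimage_bigcup -[X in measurable X]setTI; exact: measurable_tcons.
Qed.

HB.instance Definition _ := isMeasure.Build _ _ _ tuple_measure_cons
  tuple_measure_cons0 tuple_measure_cons_ge0 tuple_measure_cons_sigma_additive.

Lemma tuple_measure_cons_sigma_finite : sigma_finite setT tuple_measure_cons.
Proof.
have /sigma_finiteP[F [FT ndF Foo]] := sigma_finiteT m1.
have /sigma_finiteP[G [GT ndG Goo]] := sigma_finiteT m.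
pose u (t : n.+1.-tuple T) : T * n.-tuple T :=
  (tnth t ord0, [tuple of behead t]).
have mu : measurable_fun setT u.
  apply/measurable_fun_pairP; split => /=; first exact: measurable_tnth.
  exact: measurable_behead.
exists (fun k => u @^-1` (F k `*` G k)).
  apply/seteqP; split => // t _.
  have [i _ Fi] : (\bigcup_i F i) (u t).1 by rewrite -FT.
  have [j _ Gj] : (\bigcup_j G j) (u t).2 by rewrite -GT.
  exists (maxn i j) => //; split.
    by move: Fi; exact/subsetPset/ndF/leq_maxl.
  by move: Gj; exact/subsetPset/ndG/leq_maxr.
move=> k; have [mF Fk] := Foo k; have [mG Gk] := Goo k; split.
  by rewrite -[_ @^-1` _]setTI; apply: mu => //; exact: measurableX.
rewrite /tuple_measure_cons /pushforward -comp_preimage.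
rewrite (_ : u \o tcons = id) ?preimage_id//.
  by rewrite product_measure1E// lte_mul_pinfty// ge0_fin_numE.
by apply/funext => -[a t]; rewrite /u/=; congr pair; exact/val_inj.
Qed.

HB.instance Definition _ := Measure_isSigmaFinite.Build _ _ _ tuple_measure_cons
  tuple_measure_cons_sigma_finite.

End tuple_measure_cons.

Fixpoint lebesgue_n (R : realType) (n : nat) :
    {sigma_finite_measure set (Rn R n) -> \bar R} :=
  match n with
  | 0 => [the {sigma_finite_measure set _ -> \bar R} of \d_([tuple])]
  | n.+1 => [the {sigma_finite_measure set _ -> \bar R} of
               tuple_measure_cons (@lebesgue_measure R) (lebesgue_n R n)]
  end.

Local Notation Re := (@complex.Re _).
Local Notation Im := (@complex.Im _).

Section complex_L2.
Context d (T : measurableType d) (R : realType).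
Variable mu : {measure set T -> \bar R}.

(** Square-integrable complex functions: the real and imaginary parts are in the
    real L^2. They are Borel measurable, which gives the same classes modulo
    almost everywhere equality as Lebesgue measurability. *)
Definition L2_pred : {pred T -> R[i]} :=
  [pred f | (Re \o f \in Lfun mu 2%:E) && (Im \o f \in Lfun mu 2%:E)].

Lemma L2_submod_closed : submod_closed L2_pred.
Proof.
have p1 : (1 <= 2%:E :> \bar R)%E by rewrite lee_fin ler1n.
have [L0 LS] := Lfun_submod_closed mu p1.
have LD (f g : T -> R) : f \in Lfun mu 2%:E -> g \in Lfun mu 2%:E ->
    f + g \in Lfun mu 2%:E.
  by move=> fL gL; rewrite -[f]scale1r; exact: LS.
have LZ (a : R) (f : T -> R) : f \in Lfun mu 2%:E -> a *: f \in Lfun mu 2%:E.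
  by move=> fL; rewrite -[_ *: _]addr0; exact: LS.
split => [|[a b] f g /andP[rf mf] /andP[rg mg]]; first exact/andP.
apply/andP; split.
- rewrite (_ : Re \o _ = (a *: (Re \o f) - b *: (Im \o f)) + (Re \o g)).
    by rewrite -scaleNr; apply: (LD) => //; apply: (LD); exact: LZ.
  by apply/funext => x /=; rewrite !fctE/=; case: (f x); case: (g x).
- rewrite (_ : Im \o _ = (a *: (Im \o f) + b *: (Re \o f)) + (Im \o g)).
    by apply: (LD) => //; apply: (LD); exact: LZ.
  by apply/funext => x /=; rewrite !fctE/=; case: (f x); case: (g x).
Qed.

HB.instance Definition _ :=
  GRing.isSubmodClosed.Build R[i] (T -> R[i]) L2_pred L2_submod_closed.

Record L2_fun := L2_Fun { L2_val :> T -> R[i]; L2_valP : L2_val \in L2_pred }.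

HB.instance Definition _ := [isSub for L2_val].
HB.instance Definition _ := [Choice of L2_fun by <:].
HB.instance Definition _ := [SubChoice_isSubLmodule of L2_fun by <:].

Definition L2_eqv (f g : L2_fun) := `[< f = g %[ae mu] >].

Lemma L2_eqv_refl : reflexive L2_eqv.
Proof. by move=> f; exact/asboolP/ae_eq_refl. Qed.

Lemma L2_eqv_sym : symmetric L2_eqv.
Proof. by move=> f g; apply/asboolP/asboolP; exact: ae_eq_sym. Qed.

Lemma L2_eqv_trans : transitive L2_eqv.
Proof.
by move=> g f h /asboolP fg /asboolP gh; apply/asboolP; exact: ae_eq_trans gh.
Qed.

Canonical L2_equiv := EquivRel L2_eqv L2_eqv_refl L2_eqv_sym L2_eqv_trans.

Definition L2 := {eq_quot L2_eqv}.

HB.instance Definition _ := Choice.on L2.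
HB.instance Definition _ := EqQuotient.on L2.

Lemma L2_eqP (f g : L2_fun) : f = g %[ae mu] -> \pi_L2 f = \pi_L2 g.
Proof. by move=> fg; apply/eqmodP/asboolP. Qed.

Lemma L2_reprE (f : L2_fun) : repr (\pi_L2 f) = f %[ae mu].
Proof. by have /eqmodP/asboolP := reprK (\pi_L2 f). Qed.

Definition L2_add (u v : L2) : L2 := \pi_L2 (repr u + repr v).
Definition L2_opp (u : L2) : L2 := \pi_L2 (- repr u).
Definition L2_scale (a : R[i]) (u : L2) : L2 := \pi_L2 (a *: repr u).

Lemma pi_L2_add (f g : L2_fun) : L2_add (\pi_L2 f) (\pi_L2 g) = \pi_L2 (f + g).
Proof.
apply: L2_eqP; apply: filterS2 (L2_reprE f) (L2_reprE g) => x.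
by move=> /= fx gx _; rewrite !fctE/= fx// gx.
Qed.

Lemma pi_L2_opp (f : L2_fun) : L2_opp (\pi_L2 f) = \pi_L2 (- f).
Proof.
by apply: L2_eqP; apply: filterS (L2_reprE f) => x /= fx _; rewrite !fctE/= fx.
Qed.

Lemma pi_L2_scale a (f : L2_fun) : L2_scale a (\pi_L2 f) = \pi_L2 (a *: f).
Proof.
by apply: L2_eqP; apply: filterS (L2_reprE f) => x /= fx _; rewrite !fctE/= fx.
Qed.

Lemma L2_addA : associative L2_add.
Proof.
elim/quotW=> f; elim/quotW=> g; elim/quotW=> h.
by rewrite (pi_L2_add g h) (pi_L2_add f g) !pi_L2_add addrA.
Qed.

Lemma L2_addC : commutative L2_add.
Proof. by elim/quotW=> f; elim/quotW=> g; rewrite (pi_L2_add f g) (pi_L2_add g f) addrC. Qed.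

Lemma L2_add0 : left_id (\pi_L2 0) L2_add.
Proof. by elim/quotW=> f; rewrite pi_L2_add add0r. Qed.

Lemma L2_addN : left_inverse (\pi_L2 0) L2_opp L2_add.
Proof. by elim/quotW=> f; rewrite (pi_L2_opp f) pi_L2_add addNr. Qed.

HB.instance Definition _ :=
  GRing.isZmodule.Build L2 L2_addA L2_addC L2_add0 L2_addN.

Lemma L2_scaleA a b u : L2_scale a (L2_scale b u) = L2_scale (a * b) u.
Proof. by elim/quotW: u => f; rewrite (pi_L2_scale b f) !pi_L2_scale scalerA. Qed.

Lemma L2_scale1 : left_id 1 L2_scale.
Proof. by elim/quotW=> f; rewrite pi_L2_scale scale1r. Qed.

Lemma L2_scaleDr : right_distributive L2_scale L2_add.
Proof.
move=> a; elim/quotW=> f; elim/quotW=> g.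
rewrite (pi_L2_add f g) (pi_L2_scale a f) (pi_L2_scale a g).
by rewrite pi_L2_add pi_L2_scale scalerDr.
Qed.

Lemma L2_scaleDl u : {morph L2_scale^~ u : a b / a + b >-> a + b}.
Proof.
move=> a b; elim/quotW: u => f.
transitivity (L2_add (\pi_L2 (a *: f)) (\pi_L2 (b *: f))).
  by rewrite pi_L2_add pi_L2_scale scalerDl.
by rewrite -(pi_L2_scale a f) -(pi_L2_scale b f).
Qed.

HB.instance Definition _ := GRing.Zmodule_isLmodule.Build R[i] L2
  L2_scaleA L2_scale1 L2_scaleDr L2_scaleDl.

(** The class of [f] if [f] is square-integrable, [0] otherwise. *)
Definition L2_class (f : T -> R[i]) : L2 :=
  if insub f is Some g then \pi_L2 g else 0.

Definition cintegrable (D : set T) (f : T -> R[i]) :=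
  mu.-integrable D (fun x => (Re (f x))%:E) /\
  mu.-integrable D (fun x => (Im (f x))%:E).

Definition cintegral (D : set T) (f : T -> R[i]) : R[i] :=
  (\int[mu]_(x in D) Re (f x)) +i* (\int[mu]_(x in D) Im (f x)).

(** Linear in the first argument; independent of the representatives. *)
Definition inner (u v : L2) : R[i] :=
  cintegral setT (fun x => repr u x * (repr v x)^*).

End complex_L2.

(** Operators on L^2 are plain functions [L2 mu -> L2 mu]; linearity and boundedness
    are part of [bounded_operator]. *)

Section operators.
Context d (T : measurableType d) (R : realType).
Variable mu : {measure set T -> \bar R}.
Local Notation H := (L2 mu).

Definition L2_norm (u : H) : R := Num.sqrt (Re (inner u u)).

Definition bounded_operator (A : H -> H) :=
  linear A /\ exists M : R, forall u, L2_norm (A u) <= M * L2_norm u.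

Definition adjoint (A : H -> H) : H -> H :=
  xget (fun=> 0) [set B | forall u v, inner (A u) v = inner u (B v)].

(** In [R[i]], [0 <= z] means that [z] is real and nonnegative. *)
Definition positive_operator (A : H -> H) := forall u, 0 <= inner (A u) u.

Definition orthonormal_basis (e : nat -> H) :=
  (forall i j, inner (e i) (e j) = (i == j)%:R) /\
  (forall u, (forall n, inner u (e n) = 0) -> u = 0).

(** [P] is [|A|], the positive square root of [A^* A]. *)
Definition is_absolute_value (A P : H -> H) :=
  [/\ bounded_operator P, positive_operator P & P \o P = adjoint A \o A].

Definition trace_class (A : H -> H) :=
  bounded_operator A /\
  exists P, is_absolute_value A P /\
    forall e, orthonormal_basis e ->
      (\sum_(0 <= n <oo) (Re (inner (P (e n)) (e n)))%:E < +oo)%E.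

(** [A] is trace class and [tr(A) = t]; the sum defining the trace takes the
    same value in every orthonormal basis. *)
Definition has_trace (A : H -> H) (t : R[i]) :=
  trace_class A /\
  forall e, orthonormal_basis e ->
    series (fun n => inner (A (e n)) (e n) : R[i]^o) @ \oo --> (t : R[i]^o).

Definition linearly_independent n (v : 'I_n -> H) :=
  forall c : 'I_n -> R[i], \sum_(i < n) c i *: v i = 0 -> forall i, c i = 0.

Definition generalized_eigenspace (A : H -> H) (z : R[i]) : set H :=
  [set u | exists k, iter k (fun v => A v - z *: v) u = 0].

(** The dimension of the generalized eigenspace, possibly [+oo]; it is [0] when
    [z] is not an eigenvalue. *)
Definition algebraic_multiplicity (A : H -> H) (z : R[i]) : \bar R :=
  ereal_sup [set n%:R%:E | n in [set n | exists v : 'I_n -> H,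
    linearly_independent v /\
    forall i, generalized_eigenspace A z (v i)]].

(** The index set {i : i < N}, for N a natural number or infinity ([None]). *)
Definition index_set (N : option nat) : set nat :=
  if N is Some n then `I_n else setT.

(** [(l i)_(i < N)] lists the eigenvalues of [A] with algebraic multiplicity.
    The eigenvalue 0 is either listed like the others or left out altogether,
    since both conventions are in use. *)
Definition lists_eigenvalues (A : H -> H) (N : option nat) (l : nat -> R[i]) :=
  forall z : R[i],
    let listed := counting (index_set N `&` [set i | l i = z]) : \bar R in
    listed = algebraic_multiplicity A z \/ (z = 0 /\ listed = 0%E).

End operators.

Section time_frequency.
Context (R : realType) (d : nat).

(** Points are z = (x, omega). The sigma-algebra is that of the
    Lebesgue-measurable sets: the completion, by Caratheodory's construction,
    of the Borel product sigma-algebra. *)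
Definition phase_space :=
  caratheodory_type ((lebesgue_n R d \x lebesgue_n R d)%E^*)%mu.

Definition phase_measure : set phase_space -> \bar R :=
  @completed_measure_extension _ _ _ (lebesgue_n R d \x lebesgue_n R d)%E.

HB.instance Definition _ := Measurable.on phase_space.
HB.instance Definition _ := Measure.on phase_measure.

Definition expi (t : R) : R[i] := cos t +i* sin t.

Definition tf_shift (z : Rn R d * Rn R d) (psi : L2 (lebesgue_n R d)) :
    L2 (lebesgue_n R d) :=
  L2_class (lebesgue_n R d) (fun t : Rn R d =>
    expi (2 * pi * \sum_(i < d) tnth z.2 i * tnth t i) *
    repr psi [tuple tnth t i - tnth z.1 i | i < d]).

Definition alpha (z : Rn R d * Rn R d)
    (A : L2 (lebesgue_n R d) -> L2 (lebesgue_n R d)) :=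
  tf_shift z \o A \o adjoint (tf_shift z).

(** [K = f * S], the integral of [f z * alpha z S] over phase space, in the weak
    sense. *)
Definition is_convolution (f : phase_space -> R[i])
    (S K : L2 (lebesgue_n R d) -> L2 (lebesgue_n R d)) :=
  bounded_operator K /\
  forall psi phi,
    let g z := f z * inner (alpha z S psi) phi in
    cintegrable phase_measure setT g /\
    inner (K psi) phi = cintegral phase_measure setT g.

End time_frequency.

(* Main.v *)
(* The operator K = chi_Omega * S is positive, because <alpha_z(S) psi, psi> is <S phi, phi> with
   phi = pi(z)^* psi. For an orthonormal basis (e_n), sum_n <K e_n, e_n> is the integral over Omega
   of sum_n <S pi(z)^* e_n, pi(z)^* e_n>, which is tr(S) = 1 for every z because pi(z) is unitary.

   The sum of the eigenvalues of a positive trace class operator K is its trace. Orthonormal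
   eigenvectors v_i for the listed eigenvalues l_i are removed one after the other: what remains of
   K has its largest eigenvalue among the remaining l_i, which tend to 0, so that
   <K u, u> = sum_i l_i |<u, v_i>|^2, and Parseval gives the trace. The largest eigenvalue of a
   positive operator T is reached without any compactness argument: if A = T / sup <T u, u>, then
   n |-> <A^n u, u> is nonincreasing, so A^n u converges to a fixed vector of A; if this limit were 0
   for each vector of an orthonormal basis, A^n would tend to 0 in the Hilbert-Schmidt norm,
   contradicting the normalisation of A. *)

Require Import Defs.
From mathcomp Require Import all_boot all_order all_algebra finmap.
From mathcomp Require Import all_classical all_reals all_analysis.
From mathcomp Require Import complex.
From mathcomp Require Import measurable_realfun ring lra.

Set Implicit Arguments.
Unset Strict Implicit.
Unset Printing Implicit Defensive.
Import Order.TTheory GRing.Theory Num.Theory.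
Import numFieldNormedType.Exports.

Local Open Scope classical_set_scope.
Local Open Scope ring_scope.
Local Open Scope complex_scope.
Local Notation Re := (@complex.Re _).
Local Notation Im := (@complex.Im _).

(** * Complex numbers and abstract Hilbert spaces *)

(** The list [l] comes in an arbitrary order, so its eigenvectors cannot be produced by maximising
    the quadratic form again and again. They are fitted to the list index by index, and the maximum
    principle serves only to bound what is left of the operator after [n] removals. The fitting
    rests on two facts: for a symmetric operator generalized eigenvectors are eigenvectors, and a
    nonzero value is listed finitely often because the partial sums of the list are bounded by the
    trace.

    [has_trace] quantifies over all orthonormal bases, so the eigenvalue sum requires that one basis
    exists. It comes from Gram-Schmidt applied to the indicators of rational boxes, which form a
    total sequence; infinitely many disjoint unit cubes ensure that the process never stops, and
    this is where [0 < d] enters.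

    Completeness of L^2 is used in Parseval's identity and for the limit of the iterates [A^n u].
    The spectral argument is carried out for an abstract form [ip] with squared lengths, and reaches
    [L2] through [inner_hilbert]. *)

Lemma cReD (R : rcfType) (a b : R[i]) : Re (a + b) = Re a + Re b.
Proof. by case: a; case: b. Qed.

Lemma cReN (R : rcfType) (a : R[i]) : Re (- a) = - Re a.
Proof. by case: a. Qed.

Lemma cImD (R : rcfType) (a b : R[i]) : Im (a + b) = Im a + Im b.
Proof. by case: a; case: b. Qed.

Lemma cImN (R : rcfType) (a : R[i]) : Im (- a) = - Im a.
Proof. by case: a. Qed.

Lemma cReM (R : rcfType) (a b : R[i]) : Re (a * b) = Re a * Re b - Im a * Im b.
Proof. by case: a; case: b. Qed.

Lemma cImM (R : rcfType) (a b : R[i]) : Im (a * b) = Re a * Im b + Im a * Re b.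
Proof. by case: a => a a'; case: b => b b' /=. Qed.

Lemma cReJ (R : rcfType) (a : R[i]) : Re (a^*)%R = Re a.
Proof. by case: a. Qed.

Lemma cImJ (R : rcfType) (a : R[i]) : Im (a^*)%R = - Im a.
Proof. by case: a. Qed.

Lemma conj_realC (R : realType) (x : R) : ((x%:C)^*)%R = x%:C.
Proof. exact: conjc_real. Qed.

Lemma complex_eqP (R : rcfType) (a b : R[i]) : Re a = Re b -> Im a = Im b -> a = b.
Proof. by case: a => ? ?; case: b => ? ? /= -> ->. Qed.

Lemma Re_sum (R : rcfType) (I : Type) (r : seq I) (P : pred I) (F : I -> R[i]) :
  Re (\sum_(i <- r | P i) F i) = \sum_(i <- r | P i) Re (F i).
Proof. by apply: (big_morph Re (@cReD R)). Qed.

(** Past a term within [eps] of the infimum, all terms lie in an interval of length below [eps].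
    This is applied to Bessel remainders, to iterates of a contraction and to tails of traces. *)
Lemma nonincreasing_ge0_cauchy (R : realType) (a : nat -> R) (eps : R) :
  (forall n, a n.+1 <= a n) -> (forall n, 0 <= a n) -> 0 < eps ->
  exists N, forall m n, (N <= m)%N -> (N <= n)%N -> `|a m - a n| < eps.
Proof.
move=> ad a0 e0.
have mono m n : (m <= n)%N -> a n <= a m.
  by move/subnK <-; elim: (n - m)%N => [|k ih]; rewrite ?addSn// (le_trans (ad _)).
have hi : has_inf (range a).
  by split; [exists (a 0%N), 0%N | exists 0 => _ [n _ <-]].
have [_ [N _ <-] aN] := inf_adherent e0 hi.
have lo n : inf (range a) <= a n by apply: ge_inf; [exact: hi.2 | exists n].
exists N => m n Nm Nn; have := mono _ _ Nm; have := mono _ _ Nn.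
have := lo m; have := lo n; rewrite ltr_norml; lra.
Qed.

(** * Abstract Hilbert spaces: Bessel, Parseval, symmetric operators *)

Section inner_product.
Context (R : realType) (V : lmodType R[i]).

Definition sqnorm (z : R[i]) : R := Re z ^+ 2 + Im z ^+ 2.

Lemma sqnorm_ge0 z : 0 <= sqnorm z.
Proof. by rewrite addr_ge0// sqr_ge0. Qed.

Lemma sqnorm_eq0 z : sqnorm z = 0 -> z = 0.
Proof.
move/eqP; rewrite paddr_eq0 ?sqr_ge0// !sqrf_eq0 => /andP[/eqP a /eqP b].
exact: complex_eqP.
Qed.

Lemma sqnormJ z : sqnorm (z^*)%R = sqnorm z.
Proof. by rewrite /sqnorm cReJ cImJ sqrrN. Qed.

Lemma sqnormM a b : sqnorm (a * b) = sqnorm a * sqnorm b.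
Proof. by rewrite /sqnorm cReM cImM; ring. Qed.

Lemma mul_conj_sqnorm z : z * (z^*)%R = (sqnorm z)%:C.
Proof. by apply: complex_eqP; rewrite ?cReM ?cImM ?cReJ ?cImJ /sqnorm/=; ring. Qed.

Definition sqlen (ip : V -> V -> R[i]) (u : V) : R := Re (ip u u).

(** Completeness is phrased with squared lengths, so that square roots do not enter. [sqlen] keeps
    only the real part because [ipC] makes [ip u u] real. *)
Record hilbert_product (ip : V -> V -> R[i]) : Prop := HilbertProduct {
  ipDl : forall u v w, ip (u + v) w = ip u w + ip v w;
  ipZl : forall a u w, ip (a *: u) w = a * ip u w;
  ipC : forall u v, ip v u = ((ip u v)^*)%R;
  sqlen_ge0 : forall u, 0 <= sqlen ip u;
  sqlen_eq0 : forall u, sqlen ip u = 0 -> u = 0;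
  ip_complete : forall f : nat -> V,
    (forall eps : R, 0 < eps -> exists N, forall m n, (N <= m)%N -> (N <= n)%N ->
      sqlen ip (f m - f n) < eps) ->
    exists l, forall eps : R, 0 < eps -> exists N, forall n, (N <= n)%N ->
      sqlen ip (f n - l) < eps }.

Context (ip : V -> V -> R[i]) (H : hilbert_product ip).
Local Notation sq := (sqlen ip).

Lemma ipDr u v w : ip u (v + w) = ip u v + ip u w.
Proof. by rewrite ipC// (ipDl H) raddfD/= -!(ipC H). Qed.

Lemma ipZr a u v : ip u (a *: v) = (a^*)%R * ip u v.
Proof. by rewrite ipC// (ipZl H) rmorphM/= -(ipC H). Qed.

Lemma ip0l u : ip 0 u = 0.
Proof. by rewrite -(scale0r 0) (ipZl H) mul0r. Qed.

Lemma ip0r u : ip u 0 = 0.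
Proof. by rewrite (ipC H) ip0l rmorph0. Qed.

Lemma ipNl u v : ip (- u) v = - ip u v.
Proof. by rewrite -scaleN1r (ipZl H) mulN1r. Qed.

Lemma ipNr u v : ip u (- v) = - ip u v.
Proof. by rewrite (ipC H) ipNl rmorphN/= -(ipC H). Qed.

Lemma ipBl u v w : ip (u - v) w = ip u w - ip v w.
Proof. by rewrite (ipDl H) ipNl. Qed.

Lemma ipBr u v w : ip u (v - w) = ip u v - ip u w.
Proof. by rewrite ipDr ipNr. Qed.

Lemma ip_suml (I : Type) (r : seq I) (P : pred I) (F : I -> V) u :
  ip (\sum_(i <- r | P i) F i) u = \sum_(i <- r | P i) ip (F i) u.
Proof. by apply: (big_morph (ip ^~ u)) => [x y|]; rewrite ?(ipDl H)// ip0l. Qed.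

Lemma ip_sumr (I : Type) (r : seq I) (P : pred I) (F : I -> V) u :
  ip u (\sum_(i <- r | P i) F i) = \sum_(i <- r | P i) ip u (F i).
Proof. by apply: (big_morph (ip u)) => [x y|]; rewrite ?ipDr// ip0r. Qed.

Lemma ip_diag u : ip u u = (sq u)%:C.
Proof.
apply: complex_eqP => //=; have := congr1 Im (ipC H u u); rewrite cImJ; lra.
Qed.

Lemma Re_ipC u v : Re (ip v u) = Re (ip u v).
Proof. by rewrite (ipC H) cReJ. Qed.

Lemma sqnorm_ipC u v : sqnorm (ip v u) = sqnorm (ip u v).
Proof. by rewrite (ipC H) sqnormJ. Qed.

Lemma sqlenD u v : sq (u + v) = sq u + 2 * Re (ip u v) + sq v.
Proof.
rewrite /sqlen (ipDl H) !ipDr !cReD (Re_ipC u v); ring.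
Qed.

Lemma sqlenN u : sq (- u) = sq u.
Proof. by rewrite /sqlen ipNl ipNr opprK. Qed.

Lemma sqlenB u v : sq (u - v) = sq u - 2 * Re (ip u v) + sq v.
Proof. by rewrite sqlenD ipNr cReN sqlenN mulrN. Qed.

Lemma sqlenBC u v : sq (u - v) = sq (v - u).
Proof. by rewrite -sqlenN opprB. Qed.

Lemma sqlenZ a u : sq (a *: u) = sqnorm a * sq u.
Proof.
rewrite /sqlen (ipZl H) ipZr ip_diag /sqnorm; case: a => a b /=; ring.
Qed.

Lemma sqlen0 : sq 0 = 0.
Proof. by rewrite /sqlen ip0l. Qed.

Lemma sqlenD_le u v : sq (u + v) <= 2 * sq u + 2 * sq v.
Proof. have := sqlen_ge0 H (u - v); rewrite sqlenB sqlenD; lra. Qed.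

Lemma cauchy_schwarz u v : sqnorm (ip u v) <= sq u * sq v.
Proof.
have [v0|v0] := eqVneq (sq v) 0.
  by rewrite (sqlen_eq0 H v0) ip0r /sqnorm/= sqlen0 mulr0 !expr0n/= addr0.
have vp : 0 < sq v by rewrite lt_def v0 (sqlen_ge0 H).
have := sqlen_ge0 H ((sq v)%:C *: u - ip u v *: v).
rewrite sqlenB !sqlenZ (ipZl H) ipZr.
set c := ip u v => h.
have {}h : 0 <= sq v * (sq u * sq v - sqnorm c).
  apply: le_trans h _; rewrite /sqnorm !cReM !cImM !cReJ !cImJ/=; lra.
by rewrite pmulr_rge0// subr_ge0 in h.
Qed.

(** Polarisation: the diagonal at [u + v] compares the imaginary parts of the two sides, the one at
    [u + 'i *: v] the real parts. *)
Lemma real_diag_symmetric (T : V -> V) : linear T ->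
  (forall u, Im (ip (T u) u) = 0) -> forall u v, ip (T u) v = ip u (T v).
Proof.
move=> linT T0 u v.
have TD x y : T (x + y) = T x + T y by have := linT 1 x y; rewrite !scale1r.
have T0' : T 0 = 0 by have := linT (-1) 0 0; rewrite scaler0 addr0 scaleN1r addNr.
have TZ a x : T (a *: x) = a *: T x by have := linT a x 0; rewrite T0' !addr0.
have h1 := T0 (u + v); have h2 := T0 (u + 'i *: v).
rewrite TD (ipDl H) !ipDr !cImD !T0 in h1.
rewrite TD TZ (ipDl H) !ipDr !ipZr !(ipZl H) !cImD !cImM !cReM !T0/= in h2.
by rewrite (ipC H (T v)); apply: complex_eqP; rewrite ?cReJ ?cImJ; move: h1 h2; lra.
Qed.

Definition orthonormal (e : nat -> V) := forall i j, ip (e i) (e j) = (i == j)%:R.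

Definition total (e : nat -> V) := forall u, (forall n, ip u (e n) = 0) -> u = 0.

Definition fourier (e : nat -> V) (u : V) n := \sum_(k < n) ip u (e k) *: e k.

(* Each [v i] is allowed to be zero, so that lists with gaps are covered. *)
Definition orthosystem (v : nat -> V) :=
  (forall i j, i != j -> ip (v i) (v j) = 0) /\ (forall i, v i = 0 \/ sq (v i) = 1).

Lemma orthonormal_orthosystem e : orthonormal e -> orthosystem e.
Proof.
move=> oe; split=> [i j ij|i]; first by rewrite oe (negbTE ij).
by right; rewrite /sqlen oe eqxx.
Qed.

Lemma fourier_ip v u n i : orthosystem v ->
  ip (fourier v u n) (v i) = if (i < n)%N then ip u (v i) else 0.
Proof.
move=> [ov nv]; rewrite ip_suml.
case: ltnP => [lin|lni]; last first.
  apply: big1 => k _; rewrite (ipZl H) ov ?mulr0//.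
  by rewrite neq_ltn (leq_trans (ltn_ord k)).
rewrite (bigD1 (Ordinal lin))//= big1 ?addr0 => [|k ki]; last first.
  by rewrite (ipZl H) ov ?mulr0.
rewrite (ipZl H) ip_diag; case: (nv i) => [->|->]; last by rewrite mulr1.
by rewrite ip0r mul0r.
Qed.

Lemma fourier_resid_orth v u n i : orthosystem v -> (i < n)%N ->
  ip (u - fourier v u n) (v i) = 0.
Proof. by move=> ov lin; rewrite ipBl fourier_ip// lin subrr. Qed.

Lemma sqlen_fourier v u n : orthosystem v ->
  sq (fourier v u n) = \sum_(k < n) sqnorm (ip u (v k)).
Proof.
move=> ov; rewrite {1}/sqlen {2}/fourier ip_sumr Re_sum; apply: eq_bigr => k _.
rewrite ipZr fourier_ip// ltn_ord cReM cReJ cImJ /sqnorm; ring.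
Qed.

Lemma sqlen_fourier_resid v u n : orthosystem v ->
  sq (u - fourier v u n) = sq u - \sum_(k < n) sqnorm (ip u (v k)).
Proof.
move=> ov; rewrite sqlenB sqlen_fourier// {1}/fourier ip_sumr Re_sum.
rewrite (eq_bigr (fun k : 'I_n => sqnorm (ip u (v k)))); first by ring.
by move=> k _; rewrite ipZr cReM cReJ cImJ /sqnorm; ring.
Qed.

Lemma bessel v u n : orthosystem v -> \sum_(k < n) sqnorm (ip u (v k)) <= sq u.
Proof.
by move=> ov; rewrite -subr_ge0 -sqlen_fourier_resid// (sqlen_ge0 H).
Qed.

Lemma fourierB v u m n : orthosystem v -> (m <= n)%N ->
  sq (fourier v u n - fourier v u m) =
    \sum_(k < n) sqnorm (ip u (v k)) - \sum_(k < m) sqnorm (ip u (v k)).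
Proof.
move=> ov mn; rewrite sqlenB !sqlen_fourier//.
rewrite {2}/fourier ip_sumr Re_sum.
rewrite (eq_bigr (fun k : 'I_m => sqnorm (ip u (v k)))); first by ring.
move=> k _; rewrite ipZr fourier_ip// (leq_trans (ltn_ord k))// cReM cReJ cImJ.
by rewrite /sqnorm; ring.
Qed.

(** The Fourier sums are Cauchy by Bessel's inequality, and [u] minus their limit is orthogonal to
    every [e i], hence zero by totality. With a finite sum and an error [eps], later exchanges of
    summation remain finite. *)
Lemma parseval_le e u (eps : R) : orthonormal e -> total e -> 0 < eps ->
  exists n, sq u <= \sum_(k < n) sqnorm (ip u (e k)) + eps.
Proof.
move=> /orthonormal_orthosystem oe te eps0.
pose a n := sq u - \sum_(k < n) sqnorm (ip u (e k)).
have a0 n : 0 <= a n by rewrite subr_ge0 bessel.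
have ad n : a n.+1 <= a n.
  by rewrite /a big_ord_recr/= lerD2l lerN2 lerDl sqnorm_ge0.
have cau (r : R) : 0 < r -> exists N, forall m n, (N <= m)%N -> (N <= n)%N ->
    sq (fourier e u m - fourier e u n) < r.
  move=> /(nonincreasing_ge0_cauchy ad a0)[N hN]; exists N => m n Nm Nn.
  wlog mn : m n Nm Nn / (n <= m)%N => [hw|].
    by case: (leqP n m) => [|/ltnW] /hw; rewrite 1?sqlenBC; exact.
  rewrite fourierB//; apply: le_lt_trans (hN _ _ Nn Nm).
  by apply: le_trans (ler_norm _); rewrite /a; lra.
have [l hl] := ip_complete H cau.
have ul : u - l = 0.
  apply: te => i; apply: sqnorm_eq0; apply/eqP.
  rewrite eq_le sqnorm_ge0 andbT; apply/ler_addgt0Pl => r r0; rewrite addr0.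
  have [N hN] := hl r r0; pose n := maxn N i.+1.
  have -> : ip (u - l) (e i) = ip (fourier e u n - l) (e i).
    by rewrite !ipBl fourier_ip// leq_maxr.
  apply: le_trans (cauchy_schwarz _ _) _.
  have : sq (e i) <= 1 by case: (oe.2 i) => ->; rewrite ?sqlen0 ?ler01.
  have := hN n (leq_maxl _ _); have := sqlen_ge0 H (fourier e u n - l); nra.
have [N /(_ N (leqnn N)) hN] := hl eps eps0; exists N.
move: hN; rewrite -(subr0_eq ul) sqlenBC sqlen_fourier_resid//; lra.
Qed.

(** * Fixed vectors of positive contractions of finite trace *)

Section contraction.
Variables (A : V -> V) (e : nat -> V) (tau : R).
Hypothesis linA : linear A.
Hypothesis symA : forall u v, ip (A u) v = ip u (A v).
Hypothesis A_ge0 : forall u, 0 <= Re (ip (A u) u).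
Hypothesis A_le1 : forall u, Re (ip (A u) u) <= sq u.

Let AD x y : A (x + y) = A x + A y.
Proof. by have := linA 1 x y; rewrite !scale1r. Qed.

Let A0 : A 0 = 0.
Proof. by have := linA (-1) 0 0; rewrite scaler0 addr0 scaleN1r addNr. Qed.

Let AZ a x : A (a *: x) = a *: A x.
Proof. by have := linA a x 0; rewrite A0 !addr0. Qed.

Let AB x y : A (x - y) = A x - A y.
Proof. by rewrite AD -scaleN1r AZ scaleN1r. Qed.

Let iterB n x y : iter n A (x - y) = iter n A x - iter n A y.
Proof. by elim: n => // n ih; rewrite !iterS ih AB. Qed.

Let iter_sym n u v : ip (iter n A u) v = ip u (iter n A v).
Proof. by elim: n u v => // n ih u v; rewrite iterSr ih symA -iterS. Qed.

Let a n u := Re (ip (iter n A u) u).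

Let a0 u : a 0 u = sq u. Proof. by []. Qed.

Let ip_iter m n u : Re (ip (iter m A u) (iter n A u)) = a (n + m) u.
Proof. by rewrite -iter_sym -iterD. Qed.

Let a_even m u : a m.*2 u = sq (iter m A u).
Proof. by rewrite -addnn -ip_iter. Qed.

Let a_odd m u : a m.*2.+1 u = Re (ip (A (iter m A u)) (iter m A u)).
Proof. by rewrite -iterS ip_iter addnS addnn. Qed.

Let a_ge0 n u : 0 <= a n u.
Proof.
rewrite -(odd_double_half n); case: (odd n); rewrite ?add0n ?add1n.
  by rewrite a_odd A_ge0.
by rewrite a_even (sqlen_ge0 H).
Qed.

(* [A - A^2 = A (1 - A) A + (1 - A) A (1 - A)] *)
Let A_sqr_le u : sq (A u) <= Re (ip (A u) u).
Proof.
have := A_le1 (A u); have := A_ge0 (u - A u).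
rewrite AB ipBl !ipBr !cReD !cReN !cReD !cReN (symA (A u) u) /sqlen; lra.
Qed.

Let a_dec n u : a n.+1 u <= a n u.
Proof.
rewrite -(odd_double_half n); case: (odd n); rewrite ?add0n ?add1n.
  by rewrite a_odd -doubleS a_even iterS A_sqr_le.
by rewrite a_odd a_even A_le1.
Qed.

Let a_mono m n u : (m <= n)%N -> a n u <= a m u.
Proof.
by move/subnK <-; elim: (n - m)%N => [|k ih]; rewrite ?addSn// (le_trans (a_dec _ _)).
Qed.

Let a_convex n u : a n.+1 u - a n.+2 u <= a n u - a n.+1 u.
Proof.
have := a_ge0 n (u - A u).
rewrite /a iterB -iterSr ipBl !ipBr !cReD !cReN !cReD !cReN -!symA -!iterS; lra.
Qed.

(** By convexity none of the first [n] drops of [a] exceeds the first one. Hence if [u] nearly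
    attains the supremum of the form, [a n u] stays close to [sq u] for a fixed [n]. *)
Let a_slope n u : sq u - a n u <= n%:R * (sq u - Re (ip (A u) u)).
Proof.
have d k : a k u - a k.+1 u <= a 0 u - a 1 u.
  by elim: k => // k ih; apply: le_trans ih; exact: a_convex.
elim: n => [|n ih]; first by rewrite a0 subrr mul0r.
have := d n; rewrite -natr1 mulrDl mul1r; move: ih; rewrite /a /=/sqlen; lra.
Qed.

(** The squared distance between the iterates [m] and [n] is [a (2m) - 2 a (m+n) + a (2n)], which is
    small because [a] is nonincreasing and nonnegative. *)
Let iter_cvg u : exists w, A w = w /\ forall eps : R, 0 < eps ->
  exists N, forall n, (N <= n)%N -> sq (iter n A u - w) < eps.
Proof.
have cau (r : R) : 0 < r -> exists N, forall m n, (N <= m)%N -> (N <= n)%N ->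
    sq (iter m A u - iter n A u) < r.
  move=> r0; have r2 : 0 < r / 2 by lra.
  have [N hN] := nonincreasing_ge0_cauchy (a_dec ^~ u) (a_ge0 ^~ u) r2.
  exists N => m n Nm Nn; rewrite sqlenB -!a_even ip_iter.
  have Nmn : (N <= n + m)%N by rewrite (leq_trans Nm)// leq_addl.
  have Nm2 : (N <= m.*2)%N by rewrite -addnn (leq_trans Nm)// leq_addl.
  have Nn2 : (N <= n.*2)%N by rewrite -addnn (leq_trans Nn)// leq_addl.
  have := hN _ _ Nm2 Nmn; have := hN _ _ Nn2 Nmn.
  rewrite !ltr_norml; lra.
have [w hw] := ip_complete H cau; exists w; split=> //.
apply: subr0_eq; apply: (sqlen_eq0 H).
apply/eqP; rewrite eq_le (sqlen_ge0 H) andbT; apply/ler_addgt0Pl => r r0.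
have [N hN] := hw (r / 4) ltac:(lra).
have -> : A w - w = A (w - iter N A u) + (iter N.+1 A u - w).
  by rewrite AB iterS addrA subrK.
rewrite addr0; apply: le_trans (sqlenD_le _ _) _.
have := hN N (leqnn _); have := hN N.+1 (leqnSn _).
have := le_trans (A_sqr_le (w - iter N A u)) (A_le1 _).
rewrite (sqlenBC w); lra.
Qed.

Lemma contraction_fixpoint : orthonormal e -> total e ->
  (forall N, \sum_(k < N) Re (ip (A (e k)) (e k)) <= tau) ->
  (forall c, c < 1 -> exists u, c * sq u < Re (ip (A u) u)) ->
  exists w, w <> 0 /\ A w = w.
Proof.
move=> oe te tr sup1; apply: contrapT => nofix.
have to0 u (r : R) : 0 < r ->
    exists N, forall n, (N <= n)%N -> sq (iter n A u) < r.
  move=> r0; have [w [Aw hw]] := iter_cvg u.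
  have w0 : w = 0 by apply: contrapT => w0; apply: nofix; exists w.
  by have [N hN] := hw r r0; exists N => n /hN; rewrite w0 subr0.
have sum_to0 K (r : R) : 0 < r -> exists N, forall n, (N <= n)%N ->
    \sum_(k < K) sq (iter n A (e k)) < r.
  elim: K r => [|K ih] r r0; first by exists 0%N => n _; rewrite big_ord0.
  have [N1 h1] := ih (r / 2) ltac:(lra).
  have [N2 h2] := to0 (e K) (r / 2) ltac:(lra).
  exists (maxn N1 N2) => n; rewrite geq_max => /andP[/h1 + /h2].
  by rewrite big_ord_recr/=; lra.
pose s N := tau - \sum_(k < N) Re (ip (A (e k)) (e k)).
have s0 N : 0 <= s N by rewrite subr_ge0.
have sd N : s N.+1 <= s N by rewrite /s big_ord_recr/= lerD2l lerN2 lerDl.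
(* The sum of [sq (iter m A (e k))] is split at [K]. The head is below 1/4 for large [m]; the tail
   is below 1/4 because [a (2m) <= a 1] for [m >= 1] compares it with a tail of the trace. This is
   why [m] is at least 1. *)
have [K hK] := nonincreasing_ge0_cauchy sd s0 (ltac:(lra) : 0 < 1 / 4 :> R).
have [N hN] := sum_to0 K (1 / 4) ltac:(lra).
pose m := maxn N 1.
have small n : \sum_(k < n) sq (iter m A (e k)) <= 1 / 2.
  apply: (@le_trans _ _ (\sum_(k < K + n) sq (iter m A (e k)))).
    rewrite addnC big_split_ord/= lerDl sumr_ge0// => i _; exact: sqlen_ge0.
  rewrite big_split_ord/=.
  have h1 := hN m (leq_maxl _ _).
  have h2 : \sum_(i < n) sq (iter m A (e (K + i)%N)) <= s K - s (K + n)%N.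
    rewrite /s big_split_ord/= -subr_ge0.
    set x := \sum_(i < K) _; set y := \sum_(i < n) Re _; set z := \sum_(i < n) _.
    suff : z <= y by lra.
    apply: ler_sum => k _; rewrite -a_even.
    by apply: (@a_mono 1); rewrite double_gt0 leq_maxr.
  have := hK _ _ (leqnn K) (leq_addr n K); rewrite ltr_norml; lra.
(* By symmetry the coefficients of [A^m u] are the products of [u] with [A^m (e k)], so Parseval and
   Cauchy-Schwarz bound the norm by the Hilbert-Schmidt norm. *)
have half u : sq (iter m A u) <= sq u / 2.
  apply/ler_addgt0Pl => r r0.
  have [n hn] := parseval_le (iter m A u) oe te r0.
  apply: le_trans hn _; rewrite addrC lerD2l.
  have := ler_wpM2l (sqlen_ge0 H u) (small n); rewrite div1r.
  apply: le_trans.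
  rewrite mulr_sumr ler_sum// => k _; rewrite iter_sym.
  exact: cauchy_schwarz.
have m0 : (0 < m)%N by rewrite leq_maxr.
have m0R : 0 < m.*2%:R :> R by rewrite ltr0n double_gt0.
(* For this constant, [2m] times the first drop of [a] at [u] is less than [sq u / 2]; by [a_slope]
   then [sq (iter m A u)] exceeds [sq u / 2], against [half]. *)
have [|u hu] := sup1 (1 - (2 * m.*2%:R)^-1).
  by rewrite ltrBlDr ltrDl invr_gt0; lra.
have := a_slope m.*2 u; have := half u; rewrite a_even => h1 h2.
move: hu; rewrite mulrBl mul1r ltrBlDr -ltrBlDl => hu.
have : m.*2%:R * (sq u - Re (ip (A u) u)) < sq u / 2.
  apply: lt_le_trans (_ : m.*2%:R * ((2 * m.*2%:R)^-1 * sq u) <= _).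
    by rewrite ltr_pM2l.
  by rewrite le_eqVlt; apply/orP; left; apply/eqP; field; rewrite gt_eqF.
lra.
Qed.

End contraction.

Lemma top_eigenvector (T : V -> V) (M tau : R) (e : nat -> V) :
  linear T -> (forall u v, ip (T u) v = ip u (T v)) ->
  (forall u, 0 <= Re (ip (T u) u)) -> (forall u, Re (ip (T u) u) <= M * sq u) ->
  orthonormal e -> total e ->
  (forall N, \sum_(k < N) Re (ip (T (e k)) (e k)) <= tau) ->
  (exists u, 0 < Re (ip (T u) u)) ->
  exists lam w, [/\ 0 < lam, w <> 0, T w = lam%:C *: w &
    forall u, Re (ip (T u) u) <= lam * sq u].
Proof.
move=> linT symT T0 TM oe te tr [u0 u0p].
have sq_gt0 u : 0 < Re (ip (T u) u) -> 0 < sq u.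
  move=> Tu; rewrite lt_def (sqlen_ge0 H) andbT; apply/eqP => u00.
  by move: Tu; rewrite (sqlen_eq0 H u00) ip0r ltxx.
pose B := [set x | exists2 u, 0 < sq u & x = Re (ip (T u) u) / sq u].
have supB : has_sup B.
  split; first by exists (Re (ip (T u0) u0) / sq u0), u0 => //; exact: sq_gt0.
  by exists M => _ [u up ->]; rewrite ler_pdivrMr.
pose s := sup B.
have Ts u : Re (ip (T u) u) <= s * sq u.
  have [u00|un0] := eqVneq (sq u) 0; first by rewrite (sqlen_eq0 H u00) ip0r sqlen0 mulr0.
  have up : 0 < sq u by rewrite lt_def un0 (sqlen_ge0 H).
  by rewrite -ler_pdivrMr//; apply: sup_upper_bound => //; exists u.
have s0 : 0 < s.
  have := lt_le_trans u0p (Ts u0); rewrite pmulr_lgt0//; exact: sq_gt0.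
pose A u := (s^-1)%:C *: T u.
have ipA u v : ip (A u) v = (s^-1)%:C * ip (T u) v by rewrite (ipZl H).
have qA u : Re (ip (A u) u) = s^-1 * Re (ip (T u) u).
  by rewrite ipA cReM/= mul0r subr0.
have [|u v|u|u|N|c c1|w [w0 Aw]] :=
    @contraction_fixpoint A e (s^-1 * tau) _ _ _ _ oe te.
- by move=> a u v; rewrite /A linT scalerDr !scalerA mulrC.
- by rewrite ipA ipZr symT conj_realC.
- by rewrite qA mulr_ge0 ?invr_ge0// ltW.
- by rewrite qA mulrC ler_pdivrMr// mulrC.
- under eq_bigr do rewrite qA.
  by rewrite -mulr_sumr ler_pM2l ?invr_gt0.
- have [|x [u up ->]] := @sup_adherent _ B (s - c * s) _ supB.
    by rewrite subr_gt0 -[ltRHS]mul1r ltr_pM2r.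
  rewrite -/s opprB addrC subrK ltr_pdivlMr// => cu; exists u.
  by rewrite qA -(ltr_pM2l s0) mulrA [s * _ as X in _ < X]mulrA mulfV ?gt_eqF// mul1r [s * c]mulrC.
- exists s, w; split => //.
  by rewrite -[in RHS]Aw /A scalerA -rmorphM/= mulfV ?gt_eqF// scale1r.
Qed.

Lemma orthogonal_independent n (b : 'I_n -> V) (c : 'I_n -> R[i]) :
  (forall i j, i != j -> ip (b i) (b j) = 0) -> (forall i, b i <> 0) ->
  \sum_(i < n) c i *: b i = 0 -> forall i, c i = 0.
Proof.
move=> ob nb c0 i; have := congr1 (ip ^~ (b i)) c0.
rewrite ip_suml ip0l (bigD1 i)//= big1 => [|j ji]; last by rewrite (ipZl H) ob ?mulr0.
rewrite addr0 (ipZl H) ip_diag => /eqP; rewrite mulf_eq0 => /orP[/eqP //|].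
by rewrite -(rmorph0 (real_complex R)) => /eqP/complexI/(sqlen_eq0 H)/nb.
Qed.

(** * Eigenvectors of a symmetric operator; deflation along a list *)

Section eigenvectors.
Variables (K : V -> V).
Hypothesis linK : linear K.
Hypothesis symK : forall u v, ip (K u) v = ip u (K v).

Let KD x y : K (x + y) = K x + K y.
Proof. by have := linK 1 x y; rewrite !scale1r. Qed.

Let K0 : K 0 = 0.
Proof. by have := linK (-1) 0 0; rewrite scaler0 addr0 scaleN1r addNr. Qed.

Let KZ a x : K (a *: x) = a *: K x.
Proof. by have := linK a x 0; rewrite K0 !addr0. Qed.

Let KB x y : K (x - y) = K x - K y.
Proof. by rewrite KD -scaleN1r KZ scaleN1r. Qed.

Let K_sum (I : Type) (r : seq I) (P : pred I) (F : I -> V) :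
  K (\sum_(i <- r | P i) F i) = \sum_(i <- r | P i) K (F i).
Proof. exact: (big_morph K KD K0). Qed.

Lemma symmetric_eigenvalue_real z u : u <> 0 -> K u = z *: u -> (z^*)%R = z.
Proof.
move=> u0 Ku; have : ip (K u) u = ip u (K u) by rewrite symK.
rewrite Ku (ipZl H) ipZr ip_diag => /eqP; rewrite -subr_eq0 -mulrBl mulf_eq0.
case/orP => [|/eqP/complexI/(sqlen_eq0 H)//].
by rewrite subr_eq0 => /eqP.
Qed.

Lemma eigenvectors_orth z z' u u' : K u = z *: u -> K u' = z' *: u' -> z != z' ->
  ip u u' = 0.
Proof.
move=> Ku Ku' zz'.
have [->|/eqP u0] := eqVneq u 0; first by rewrite ip0l.
have [->|/eqP u0'] := eqVneq u' 0; first by rewrite ip0r.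
have : ip (K u) u' = ip u (K u') by rewrite symK.
rewrite Ku Ku' (ipZl H) ipZr (symmetric_eigenvalue_real u0' Ku') => /eqP.
by rewrite -subr_eq0 -mulrBl mulf_eq0 subr_eq0 (negbTE zz') => /eqP.
Qed.

(* [K - z] is normal, so [(K - z)^2 u = 0] gives [(K - z)^* (K - z) u = 0]. *)
Lemma symmetric_generalized_eigenvector z k u :
  iter k (fun v => K v - z *: v) u = 0 -> K u = z *: u.
Proof.
set B := fun v => K v - z *: v.
have B0 : B 0 = 0 by rewrite /B K0 scaler0 subr0.
have B2 v : B (B v) = 0 -> B v = 0.
  move=> BBv; apply: (sqlen_eq0 H).
  have Bs x y : ip (B x) y = ip x (K y - (z^*)%R *: y).
    by rewrite ipBl symK (ipZl H) ipBr ipZr conjCK.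
  have Bn x : sq (K x - (z^*)%R *: x) = sq (B x).
    rewrite !sqlenB !sqlenZ sqnormJ !ipZr conjCK.
    have := congr1 Im (ipC H (K x) x).
    rewrite -symK cImJ !cReM !cReJ !cImJ => ?; nra.
  rewrite /sqlen Bs (_ : K _ - _ = 0) ?ip0r//.
  by apply: (sqlen_eq0 H); rewrite Bn BBv sqlen0.
move=> Bk; apply: subr0_eq; rewrite -/(B u).
elim: k Bk => [|[|k] ih]; [by move=> /= ->|by []|].
by move=> /B2; exact: ih.
Qed.

Section trace.
Variables (e : nat -> V) (tau M : R) (l : nat -> R[i]) (v : nat -> V).
Hypothesis K_ge0 : forall u, 0 <= Re (ip (K u) u).
Hypothesis K_le : forall u, Re (ip (K u) u) <= M * sq u.
Hypothesis oe : orthonormal e.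
Hypothesis te : total e.
Hypothesis tr_le : forall N, \sum_(k < N) Re (ip (K (e k)) (e k)) <= tau.
Hypothesis ov : orthosystem v.
Hypothesis Kv : forall i, K (v i) = l i *: v i.
Hypothesis lv : forall i, v i = 0 -> l i = 0.

Let sqv i : v i != 0 -> sq (v i) = 1.
Proof. by case: (ov.2 i) => -> //; rewrite eqxx. Qed.

Let lE i : l i = (Re (ip (K (v i)) (v i)))%:C.
Proof.
have [v0|vn0] := eqVneq (v i) 0; first by rewrite lv// v0 ip0r.
rewrite Kv (ipZl H) ip_diag sqv// mulr1.
have /(congr1 Im) := symmetric_eigenvalue_real (elimN eqP vn0) (Kv i).
by rewrite cImJ => h; apply: complex_eqP => //=; lra.
Qed.

Lemma listed_eigenvalue_ge0 i : 0 <= Re (l i).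
Proof. by rewrite lE; exact: K_ge0. Qed.

Lemma listed_eigenvalue_real i : ((l i)^*)%R = l i.
Proof. by rewrite lE conj_realC. Qed.

(** [K] after the projection onto the orthogonal complement of the first [n] vectors. The projection
    commutes with [K] by [K_fourier], so this operator is again symmetric and positive. *)
Let defl n u := K (u - fourier v u n).

Let fourierZD n a x y : fourier v (a *: x + y) n = a *: fourier v x n + fourier v y n.
Proof.
rewrite /fourier scaler_sumr -big_split/=; apply: eq_bigr => k _.
by rewrite (ipDl H) (ipZl H) scalerDl scalerA.
Qed.

Let fourier_sym n x y : ip (fourier v x n) y = ip x (fourier v y n).
Proof.
rewrite ip_suml ip_sumr; apply: eq_bigr => k _.
by rewrite (ipZl H) ipZr (ipC H y (v k)) mulrC.
Qed.

Let K_fourier n x : K (fourier v x n) = fourier v (K x) n.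
Proof.
rewrite K_sum; apply: eq_bigr => k _; rewrite KZ Kv scalerA symK Kv ipZr.
by rewrite listed_eigenvalue_real mulrC.
Qed.

Let defl_linear n : linear (defl n).
Proof.
by move=> a x y; rewrite /defl fourierZD opprD addrACA -scalerBr linK.
Qed.

Let defl_sym n x y : ip (defl n x) y = ip x (defl n y).
Proof.
by rewrite /defl symK !ipBl KB ipBr fourier_sym K_fourier.
Qed.

Let deflE n u : Re (ip (defl n u) u) =
  Re (ip (K u) u) - \sum_(k < n) Re (l k) * sqnorm (ip u (v k)).
Proof.
rewrite /defl KB ipBl cReD cReN K_fourier; congr (_ - _).
rewrite ip_suml Re_sum; apply: eq_bigr => k _.
rewrite symK Kv (ipZl H) ipZr listed_eigenvalue_real (ipC H u (v k)).
by rewrite lE /sqnorm !cReM !cImM !cReJ !cImJ/=; ring.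
Qed.

Let defl_ge0 n u : 0 <= Re (ip (defl n u) u).
Proof.
have := K_ge0 (u - fourier v u n); rewrite -/(defl n u) ipBr cReD cReN.
suff -> : ip (defl n u) (fourier v u n) = 0 by rewrite /= oppr0 addr0.
rewrite ip_sumr big1// => k _; rewrite ipZr /defl symK Kv ipZr.
by rewrite fourier_resid_orth// !mulr0.
Qed.

(** Write [l i] as [l i] times [sq (v i)], expand in [e] by Parseval and exchange the sums:
    positivity of the deflated operator bounds the inner sum by the diagonal entry of [K] at
    [e k]. *)
Lemma listed_eigenvalues_sum_le n : \sum_(i < n) Re (l i) <= tau.
Proof.
pose L := \sum_(i < n) Re (l i).
have L0 : 0 <= L by apply: sumr_ge0 => i _; exact: listed_eigenvalue_ge0.
apply/ler_addgt0Pl => r r0.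
(* The errors, weighted by the [l i], add up to [L * (r / (1 + L)) <= r]; the 1 covers the case
   [L = 0]. *)
have eps0 : 0 < r / (1 + L) by rewrite divr_gt0// ltr_pwDl.
have [N hN] : exists N, forall i, (i < n)%N ->
    sq (v i) <= \sum_(k < N) sqnorm (ip (v i) (e k)) + r / (1 + L).
  elim: n {L L0 eps0} (r / (1 + L)) eps0 => [|m ih] eps eps0; first by exists 0%N.
  have [N1 h1] := ih eps eps0.
  have [N2 h2] := parseval_le (v m) oe te eps0.
  have mono a b u : (a <= b)%N -> \sum_(k < a) sqnorm (ip u (e k)) <=
      \sum_(k < b) sqnorm (ip u (e k)).
    move=> /subnKC <-; rewrite big_split_ord/= lerDl.
    by apply: sumr_ge0 => *; exact: sqnorm_ge0.
  exists (maxn N1 N2) => i; rewrite ltnS leq_eqVlt => /orP[/eqP ->|/h1 {}h1].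
    by apply: le_trans h2 _; rewrite lerD2r mono// leq_maxr.
  by apply: le_trans h1 _; rewrite lerD2r mono// leq_maxl.
apply: (@le_trans _ _ (\sum_(i < n)
    Re (l i) * (\sum_(k < N) sqnorm (ip (v i) (e k)) + r / (1 + L)))).
  apply: ler_sum => i _.
  have [v0|vn0] := eqVneq (v i) 0; first by rewrite lv//= mul0r.
  apply: le_trans (ler_wpM2l (listed_eigenvalue_ge0 i) (hN i (ltn_ord i))).
  by rewrite sqv// mulr1.
under eq_bigr do rewrite mulrDr mulr_sumr.
rewrite big_split/= -mulr_suml addrC lerD//.
  rewrite -/L mulrCA ger_pMr// ler_pdivrMr ?mul1r; last by rewrite ltr_pwDl.
  lra.
rewrite exchange_big/=; apply: le_trans (tr_le N); apply: ler_sum => k _.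
have := defl_ge0 n (e k); rewrite deflE subr_ge0; apply: le_trans.
by apply: ler_sum => i _; rewrite sqnorm_ipC.
Qed.

(** The first hypothesis says that [v] misses no eigenvector of nonzero eigenvalue. A top
    eigenvector of the deflated operator is orthogonal to the first [n] vectors, so it meets a later
    [v j]; its eigenvalue is then [l j], which is small for large [n]. *)
Lemma listed_eigenvalues_sum_ge (eps : R) :
  (forall z w, z != 0 -> K w = z *: w -> (forall i, ip w (v i) = 0) -> w = 0) ->
  0 < eps -> forall N, exists n,
    \sum_(k < N) Re (ip (K (e k)) (e k)) <= \sum_(i < n) Re (l i) + eps.
Proof.
move=> vmax eps0 N.
pose s n := tau - \sum_(i < n) Re (l i).
have s0 n : 0 <= s n by rewrite subr_ge0 listed_eigenvalues_sum_le.
have sd n : s n.+1 <= s n by rewrite /s big_ord_recr/= lerD2l lerN2 lerDl listed_eigenvalue_ge0.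
(* The loss allowed for each of the [N] diagonal terms; [N.+1] keeps it positive at [N = 0]. *)
have r0 : 0 < eps / N.+1%:R by rewrite divr_gt0.
have [n hn] := nonincreasing_ge0_cauchy sd s0 r0.
have small i : (n <= i)%N -> Re (l i) < eps / N.+1%:R.
  move=> ni; have := le_lt_trans (ler_norm _) (hn i i.+1 ni (leqW ni)).
  by rewrite (_ : s i - s i.+1 = Re (l i))// /s big_ord_recr/=; ring.
have qn u : Re (ip (defl n u) u) <= eps / N.+1%:R * sq u.
  have [[u1 u1p]|no] := pselect (exists u, 0 < Re (ip (defl n u) u)); last first.
    apply: le_trans (_ : 0 <= _).
      by rewrite leNgt; apply/negP => h; apply: no; exists u.
    by rewrite mulr_ge0 ?(sqlen_ge0 H)// ltW.
  have [x|k||lam [w [lam0 w0 Tw lamtop]]] :=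
    @top_eigenvector (defl n) M tau e (@defl_linear n) (@defl_sym n) (defl_ge0 n) _ oe te.
  - rewrite (le_trans _ (K_le x))// deflE gerBl sumr_ge0// => i _.
    by rewrite mulr_ge0 ?sqnorm_ge0// listed_eigenvalue_ge0.
  - apply: le_trans (tr_le k); apply: ler_sum => i _.
    by rewrite deflE gerBl sumr_ge0// => j _; rewrite mulr_ge0 ?sqnorm_ge0// listed_eigenvalue_ge0.
  - by exists u1.
  have lamn0 : lam%:C != 0 :> R[i] by rewrite -(rmorph0 (real_complex R)) (inj_eq (@complexI _)) gt_eqF.
  have worth i : (i < n)%N -> ip w (v i) = 0.
    move=> lin; apply: (mulfI lamn0); rewrite mulr0 -(ipZl H) -Tw.
    by rewrite /defl symK Kv ipZr fourier_resid_orth// mulr0.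
  have Kw : K w = lam%:C *: w.
    rewrite -Tw /defl (_ : fourier v w n = 0) ?subr0//.
    by apply: big1 => k _; rewrite worth// scale0r.
  have [j jn] : exists j, ip w (v j) != 0.
    apply: contrapT => /forallNP no; apply: w0; apply: vmax lamn0 Kw _ => i.
    by apply/eqP/negPn/negP; exact: no.
  have nj : (n <= j)%N.
    by rewrite leqNgt; apply/negP => /worth jw; rewrite jw eqxx in jn.
  have lj : lam%:C = l j.
    by apply/eqP; apply: contraNT jn => ne; rewrite (eigenvectors_orth Kw (Kv j) ne).
  apply: le_trans (lamtop u) _; apply: ler_wpM2r; first exact: (sqlen_ge0 H).
  by have := small j nj; rewrite -lj => /ltW.
exists n.
apply: (@le_trans _ _ (\sum_(k < N)
    (\sum_(i < n) Re (l i) * sqnorm (ip (e k) (v i)) + eps / N.+1%:R))).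
  apply: ler_sum => k _; rewrite addrC -lerBlDr -deflE; apply: le_trans (qn _) _.
  by rewrite /sqlen oe eqxx mulr1.
rewrite big_split/= lerD//; last first.
  by rewrite sumr_const card_ord -[leLHS]mulr_natl mulrCA ger_pMr// ler_pdivrMr// mul1r ler_nat.
rewrite exchange_big/=; apply: ler_sum => i _; rewrite -mulr_sumr.
have [v0|vn0] := eqVneq (v i) 0; first by rewrite lv// mul0r.
apply: ler_piMr; [exact: listed_eigenvalue_ge0|rewrite -(sqv vn0)].
under eq_bigr do rewrite sqnorm_ipC.
exact: bessel (orthonormal_orthosystem oe).
Qed.

End trace.
End eigenvectors.

End inner_product.

(** * Listing the eigenvectors; Gram-Schmidt *)

Lemma counting_seq (T : choiceType) (R : realType) (s : seq T) : uniq s ->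
  counting [set` s] = (size s)%:R%:E :> \bar R.
Proof.
move=> us; rewrite /counting asboolT ?finite_seq//.
have -> : [set` s] = [set` [fset x in s]%fset].
  by apply/seteqP; split => x /=; rewrite inE.
by rewrite set_fsetK card_fseq undup_id.
Qed.

Lemma counting_subset (T : choiceType) (R : realType) (A B : set T) : A `<=` B ->
  (counting A <= counting B :> \bar R)%E.
Proof.
move=> AB; rewrite /counting; case: (asboolP (finite_set B)) => [fB|_]; last by rewrite leey.
have fA : finite_set A by exact: sub_finite_set fB.
by rewrite asboolT// lee_fin ler_nat fsubset_leq_card// -fset_set_sub.
Qed.

Lemma strong_recursion (T : Type) (F : seq T -> T) :
  exists v : nat -> T, forall n, v n = F (mkseq v n).
Proof.
pose s n := iter n (fun s => rcons s (F s)) [::].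
exists (fun n => F (s n)) => n; congr F.
by elim: n => // n ih; rewrite mkseqS/= -ih.
Qed.

Section inner_product.
Context (R : realType) (V : lmodType R[i]).
Context (ip : V -> V -> R[i]) (H : hilbert_product ip).
Local Notation sq := (sqlen ip).

Lemma normalize u : u <> 0 -> exists2 c : R[i], c != 0 & sq (c *: u) = 1.
Proof.
move=> u0; have up : 0 < sq u.
  rewrite lt_def (sqlen_ge0 H) andbT; apply/eqP => /(sqlen_eq0 H); exact: u0.
exists ((Num.sqrt (sq u))^-1)%:C.
  by rewrite -(rmorph0 (real_complex R)) (inj_eq (@complexI _)) invr_eq0 gt_eqF// sqrtr_gt0.
rewrite (sqlenZ H) /sqnorm/= expr0n/= addr0 exprVn sqr_sqrtr ?ltW//.
by rewrite mulVf// gt_eqF.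
Qed.

(** The matrix of inner products has more rows than columns, so a nonzero row vector annihilates
    it. *)
Lemma orthogonal_combination n m (b : 'I_n -> V) (x : 'I_m -> V) : (m < n)%N ->
  (forall c : 'I_n -> R[i], \sum_(i < n) c i *: b i = 0 -> forall i, c i = 0) ->
  exists2 c : 'I_n -> R[i], \sum_(i < n) c i *: b i <> 0 &
    forall j, ip (\sum_(i < n) c i *: b i) (x j) = 0.
Proof.
move=> mn indep; pose M : 'M[R[i]]_(n, m) := \matrix_(i, j) ip (b i) (x j).
have : kermx M != 0.
  by rewrite -mxrank_eq0 mxrank_ker subn_eq0 -ltnNge (leq_ltn_trans (rank_leq_col _)).
case/rowV0Pn => c /sub_kermxP cM c0; exists (c 0).
  move=> /indep cz; case/eqP: c0; apply/rowP => i; by rewrite cz mxE.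
move=> j; rewrite (ip_suml H).
transitivity ((c *m M) 0 j); last by rewrite cM mxE.
by rewrite mxE; apply: eq_bigr => i _; rewrite (ipZl H) mxE.
Qed.

(** * Orthonormal eigenvectors fitted to a given list of eigenvalues *)

Section listing.
Variables (K : V -> V) (e : nat -> V) (tau M : R) (l : nat -> R[i]).
Hypothesis linK : linear K.
Hypothesis symK : forall u v, ip (K u) v = ip u (K v).
Hypothesis K_ge0 : forall u, 0 <= Re (ip (K u) u).
Hypothesis K_le : forall u, Re (ip (K u) u) <= M * sq u.
Hypothesis oe : orthonormal ip e.
Hypothesis te : total ip e.
Hypothesis tr_le : forall N, \sum_(k < N) Re (ip (K (e k)) (e k)) <= tau.
Hypothesis lmult : forall z, z != 0 -> counting [set i | l i = z] =
  ereal_sup [set (n%:R%:E : \bar R) | n in [set n | exists b : 'I_n -> V,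
    (forall c : 'I_n -> R[i], \sum_(i < n) c i *: b i = 0 -> forall i, c i = 0) /\
    forall i, exists k, iter k (fun v => K v - z *: v) (b i) = 0]].

Let occ z N := [seq j <- iota 0 N | l j == z].

Let occP z N j : (j \in occ z N) = (l j == z) && (j < N)%N.
Proof. by rewrite mem_filter mem_iota add0n leq0n. Qed.

Let KD x y : K (x + y) = K x + K y.
Proof. by have := linK 1 x y; rewrite !scale1r. Qed.

Let K0 : K 0 = 0.
Proof. by have := linK (-1) 0 0; rewrite scaler0 addr0 scaleN1r addNr. Qed.

Let KZ a x : K (a *: x) = a *: K x.
Proof. by have := linK a x 0; rewrite K0 !addr0. Qed.

Let eigen_sum z n (b : 'I_n -> V) (c : 'I_n -> R[i]) :
  (forall i, K (b i) = z *: b i) ->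
  K (\sum_(i < n) c i *: b i) = z *: \sum_(i < n) c i *: b i.
Proof.
move=> Kb; rewrite (big_morph K KD K0) scaler_sumr; apply: eq_bigr => i _.
by rewrite KZ Kb !scalerA mulrC.
Qed.

(** The indices in [occ z i] and [i] itself all carry [z], so the multiplicity, a supremum, exceeds
    [size (occ z i)], and some independent family is already larger than that. *)
Let enough z i : z != 0 -> l i = z -> exists n (b : 'I_n -> V),
  [/\ (size (occ z i) < n)%N,
    (forall c : 'I_n -> R[i], \sum_(i < n) c i *: b i = 0 -> forall i, c i = 0) &
    forall i, K (b i) = z *: b i].
Proof.
move=> z0 li; have : ((size (occ z i))%:R%:E < counting [set i | l i = z] :> \bar R)%E.
  apply: (@lt_le_trans _ _ (counting [set` occ z i.+1])).
    rewrite counting_seq ?filter_uniq ?iota_uniq// lte_fin ltr_nat.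
    by rewrite /occ -[in iota 0 i.+1]addn1 iotaD filter_cat size_cat/= add0n li eqxx addn1.
  apply: counting_subset => j/=; rewrite occP => /andP[/eqP //].
rewrite lmult// => /ereal_sup_gt[_ [n [b [indep bk]] <-]].
rewrite lte_fin ltr_nat => lt; exists n, b; split => // j.
by have [k] := bk j; exact: (symmetric_generalized_eigenvector H linK symK).
Qed.

Let not_more z N n (b : 'I_n -> V) : z != 0 -> (forall j, l j = z -> (j < N)%N) ->
  (forall c : 'I_n -> R[i], \sum_(i < n) c i *: b i = 0 -> forall i, c i = 0) ->
  (forall i, K (b i) = z *: b i) -> (n <= size (occ z N))%N.
Proof.
move=> z0 lN indep Kb; rewrite -(ler_nat R) -lee_fin.
have -> : (size (occ z N))%:R%:E = counting [set i | l i = z] :> \bar R.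
  rewrite -counting_seq ?filter_uniq ?iota_uniq//; congr counting.
  apply/seteqP; split => j /=; rewrite occP; first by case/andP => /eqP.
  by move=> lj; rewrite (lN j lj) lj eqxx.
rewrite lmult//; apply: ereal_sup_ubound; exists n => //.
by exists b; split => // i; exists 1%N; rewrite /= Kb subrr.
Qed.

(** At index [i] the recursion picks a unit eigenvector for [l i] orthogonal to all earlier choices,
    and the default 0 of [xget] if [l i] is 0 or no such vector exists. The second case is excluded
    by [lv]. *)
Lemma eigenvector_listing : exists v, [/\ orthosystem ip v,
  forall i, K (v i) = l i *: v i, forall i, v i = 0 -> l i = 0 &
  forall z w, z != 0 -> K w = z *: w -> (forall i, ip w (v i) = 0) -> w = 0].
Proof.
pose good (s : seq V) w := [/\ l (size s) != 0, sq w = 1, K w = l (size s) *: w &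
  forall x, x \in s -> ip w x = 0].
pose F s := xget 0 [set w | good s w].
have [v vF] := strong_recursion F.
have vP n : v n = 0 \/ [/\ l n != 0, sq (v n) = 1, K (v n) = l n *: v n &
    forall j, (j < n)%N -> ip (v n) (v j) = 0].
  have [gw|no] := pselect (exists w, good (mkseq v n) w); last first.
    by left; rewrite vF /F xgetPN// => w gw; apply: no; exists w.
  have : good (mkseq v n) (v n) by rewrite [v n]vF; exact: xgetPex gw.
  rewrite /good/= size_mkseq => -[? ? ? h]; right; split => // j jn.
  by apply: h; apply/mapP; exists j => //; rewrite mem_iota.
have Kv i : K (v i) = l i *: v i by case: (vP i) => [->|[]//]; rewrite K0 scaler0.
have orthlt i j : (j < i)%N -> ip (v i) (v j) = 0.
  by case: (vP i) => [-> _|[_ _ _ /(_ j)]//]; rewrite (ip0l H).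
have ov : orthosystem ip v.
  split => [i j|i]; last by case: (vP i) => [|[]]; [left|right].
  rewrite neq_ltn => /orP[/orthlt ij|/orthlt //].
  by rewrite (ipC H) ij rmorph0.
(* Earlier vectors for other eigenvalues are orthogonal by symmetry. Those for [l i] are fewer than
   the independent eigenvectors given by [enough], so a nonzero combination of the latter is
   orthogonal to them. *)
have lv i : v i = 0 -> l i = 0.
  move=> vi0; apply: contrapT => /eqP li.
  have [n [b [nb indep Kb]]] := enough li erefl.
  have [c w0 worth] :=
    orthogonal_combination (fun j => v (nth 0%N (occ (l i) i) j)) nb indep.
  have Kw := eigen_sum c Kb; move: w0 worth Kw; set w := \sum_(_ < _) _.
  move=> w0 worth Kw; have [a a0 aw] := normalize w0.
  have : good (mkseq v i) (v i).
    rewrite vF; apply: xgetPex; exists (a *: w); rewrite /good/= size_mkseq.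
    split => //; first by rewrite KZ Kw !scalerA mulrC.
    move=> _ /mapP[j + ->]; rewrite mem_iota/= add0n (ipZl H) => ji.
    have [lj|lj] := eqVneq (l i) (l j); last first.
      by rewrite (eigenvectors_orth H symK Kw (Kv j)) ?mulr0.
    have jo : j \in occ (l i) i by rewrite occP lj eqxx.
    rewrite -(nth_index 0%N jo); move: jo; rewrite -index_mem => jo.
    by rewrite (worth (Ordinal jo)) mulr0.
  by case => _ + _ _; rewrite vi0 (sqlen0 H) => /esym/eqP; rewrite oner_eq0.
exists v; split => // z w z0 Kw wv.
(* If [z] were listed infinitely often, it would be positive and the partial sums of [l] would
   exceed every multiple of it, although they are at most [tau]. *)
have [[N lN]|noN] := pselect (exists N, forall j, l j = z -> (j < N)%N); last first.
  have {}noN N : exists2 j, (N <= j)%N & l j = z.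
    apply: contrapT => no; apply: noN; exists N => j lj.
    by rewrite ltnNge; apply/negP => Nj; apply: no; exists j.
  have lge0 := listed_eigenvalue_ge0 H symK K_ge0 ov Kv lv.
  have zp : 0 < Re z.
    have [j _ lj] := noN 0%N; rewrite lt_def -lj lge0 andbT.
    apply: contra_neq z0 => lj0; rewrite -lj; apply: complex_eqP => //.
    have := congr1 Im (listed_eigenvalue_real H symK ov Kv lv j).
    by rewrite cImJ/=; lra.
  have grow p : exists n, p%:R * Re z <= \sum_(i < n) Re (l i).
    elim: p => [|p [n ih]]; first by exists 0%N; rewrite mul0r big_ord0.
    have [j nj lj] := noN n; exists j.+1.
    rewrite big_ord_recr/= lj -natr1 mulrDl mul1r lerD2r (le_trans ih)//.
    by rewrite -(subnKC nj) big_split_ord/= lerDl sumr_ge0.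
  have [n] := grow (Num.truncn (tau / Re z)).+1; move=> h.
  have := le_trans h (listed_eigenvalues_sum_le H linK symK K_ge0 oe te tr_le ov Kv lv n).
  by rewrite leNgt -ltr_pdivrMr// truncnS_gt.
apply: contrapT => w0.
pose s := occ z N.
have us : uniq s by rewrite filter_uniq// iota_uniq.
have vn j : j \in s -> v j <> 0.
  by rewrite occP => /andP[/eqP lj _] /lv; rewrite lj => /eqP; rewrite (negbTE z0).
(* Adding [w] to the listed eigenvectors for [z] yields one independent eigenvector more than [z]
   has occurrences. *)
pose b (a : 'I_(size s).+1) := if unlift ord0 a is Some j then v (nth 0%N s j) else w.
suff : (size s < size s)%N by rewrite ltnn.
apply: (@not_more z N _ b z0 lN).
- move=> c; apply: (orthogonal_independent H) => [i j|i]; rewrite /b.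
    case: (unliftP ord0 i) => [i' ->|->]; case: (unliftP ord0 j) => [j' ->|->];
      rewrite ?eqxx// => ij.
    + apply: ov.1; rewrite nth_uniq ?ltn_ord//.
    + by rewrite (ipC H) wv rmorph0.
  case: (unliftP ord0 i) => // i' _; apply: vn; exact: mem_nth.
- move=> i; rewrite /b; case: (unlift _ _) => // j.
  have : nth 0%N s j \in s by exact: mem_nth.
  by rewrite occP Kv => /andP[/eqP ->].
Qed.

End listing.

Lemma eq_fourier (v v' : nat -> V) u n : (forall i, (i < n)%N -> v i = v' i) ->
  fourier ip v u n = fourier ip v' u n.
Proof. by move=> vv; apply: eq_bigr => k _; rewrite vv. Qed.

(* Truncating an orthonormal list at [n] gives a system to which Bessel applies. *)
Let trunc (v : nat -> V) n i := if (i < n)%N then v i else 0.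

(** * Gram-Schmidt for a total sequence in infinite dimension *)

Section gram_schmidt.
Variables (g h : nat -> V).
Hypothesis gtotal : total ip g.
Hypothesis oh : orthonormal ip h.

Let resid (s : seq V) u := u - \sum_(x <- s) ip u x *: x.

Let resid_mkseq (v : nat -> V) n u : resid (mkseq v n) u = u - fourier ip v u n.
Proof. by rewrite /resid /mkseq big_map -{1}(subn0 n) big_mkord. Qed.

Lemma gram_schmidt : exists2 e, orthonormal ip e & total ip e.
Proof.
(* The next vector is the normalised residual of the first [g k] outside the span of [s]; passing
   over dependent [g k] leaves no zero vectors in [e]. *)
pose good s w := exists k c, [/\ forall j, (j < k)%N -> resid s (g j) = 0,
   resid s (g k) <> 0, w = c *: resid s (g k), c != 0 & sq w = 1].
have [e eF] := strong_recursion (fun s => xget 0 [set w | good s w]).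
have ot n : (forall i j, (i < n)%N -> (j < n)%N -> ip (e i) (e j) = (i == j)%:R) ->
    orthosystem ip (trunc e n).
  move=> en; split => [i j ij|i]; rewrite /trunc.
    by do 2 case: ifP => ?; rewrite ?(ip0l H) ?(ip0r H)// en// (negbTE ij).
  by case: ifP => ?; [right; rewrite /sqlen en// eqxx|left].
have fe n u : fourier ip e u n = fourier ip (trunc e n) u n.
  by apply: eq_fourier => i lin; rewrite /trunc lin.
have eg n : (forall i j, (i < n)%N -> (j < n)%N -> ip (e i) (e j) = (i == j)%:R) ->
    good (mkseq e n) (e n).
  move=> en; rewrite eF; apply: xgetPex.
  (* Otherwise totality of [g] makes every vector equal to its projection on [n] orthonormal
     vectors, and by Bessel the [n + 1] unit vectors [h j] have total squared length at most [n]. *)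
  have ex : exists k, resid (mkseq e n) (g k) != 0.
    apply: contrapT => /forallNP no.
    have r0 u : u = fourier ip e u n.
      apply: subr0_eq; apply: gtotal => k.
      have /negP/negPn/eqP := no k; rewrite resid_mkseq => /subr0_eq ->.
      rewrite {2}/fourier (ip_sumr H) big1// => i _.
      rewrite (ipZr H) fe; have := fourier_resid_orth H u (ot n en) (ltn_ord i).
      by rewrite {2}/trunc ltn_ord => ->; rewrite mulr0.
    have h1 j : sq (h j) = \sum_(k < n) sqnorm (ip (trunc e n k) (h j)).
      rewrite {1}[h j]r0 fe (sqlen_fourier H); last exact: ot.
      apply: eq_bigr => k _; exact: sqnorm_ipC.
    have : \sum_(j < n.+1) sq (h j) <= n%:R.
      under eq_bigr do rewrite h1.
      rewrite exchange_big/= -[n in n%:R]card_ord -sumr_const; apply: ler_sum => k _.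
      apply: le_trans (bessel H _ _ (orthonormal_orthosystem oh)) _.
      by rewrite /trunc ltn_ord /sqlen en// eqxx.
    rewrite (eq_bigr (fun=> 1)) => [|j _]; last by rewrite /sqlen oh eqxx.
    by rewrite sumr_const card_ord ler_nat ltnn.
  have [k rk kmin] := ex_minnP ex.
  have [c c0 c1] := normalize (elimN eqP rk).
  exists (c *: resid (mkseq e n) (g k)), k, c; split => //; last exact/eqP.
  move=> j jk; apply/eqP/negPn/negP => /kmin; by rewrite leqNgt jk.
have en n : forall i j, (i < n)%N -> (j < n)%N -> ip (e i) (e j) = (i == j)%:R.
  elim: n => // n ih.
  have [k [c [_ _ en _ en1]]] := eg n ih.
  have eno i : (i < n)%N -> ip (e n) (e i) = 0.
    move=> lin; rewrite en (ipZl H) resid_mkseq fe.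
    have := fourier_resid_orth H (g k) (ot n ih) lin.
    by rewrite {2}/trunc lin => ->; rewrite mulr0.
  move=> i j; rewrite !ltnS (leq_eqVlt i) (leq_eqVlt j).
  case/orP => [/eqP ->|lin] /orP[/eqP ->|ljn].
  - by rewrite eqxx (ip_diag H) en1.
  - by rewrite eno// gtn_eqF.
  - by rewrite (ipC H) eno// rmorph0 ltn_eqF.
  - exact: ih.
have oe : orthonormal ip e.
  by move=> i j; apply: (en (maxn i j).+1); rewrite ltnS ?leq_maxl ?leq_maxr.
have oes := orthonormal_orthosystem oe.
have fS n u : fourier ip e u n.+1 = fourier ip e u n + ip u (e n) *: e n.
  by rewrite /fourier big_ord_recr.
have persist n u : u = fourier ip e u n -> u = fourier ip e u n.+1.
  move=> un; have une : ip u (e n) = 0 by rewrite un (fourier_ip H _ _ _ oes) ltnn.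
  by rewrite fS -un une scale0r addr0.
(* At stage [n] the first nonzero residual has index [k >= n] by induction. If [k = n], the new
   vector absorbs the residual of [g n]; if [k > n], that residual was already zero. *)
have kill n j : (j < n)%N -> g j = fourier ip e (g j) n.
  elim: n j => // n ih j; rewrite ltnS leq_eqVlt => /orP[/eqP ->|/ih]; last exact: persist.
  have [k [c [kmin rk enE c0 en1]]] := eg n (en n).
  have [kn|nk|kn] := ltngtP k n.
  - by case: rk; rewrite resid_mkseq -ih// subrr.
  - by apply: persist; apply: subr0_eq; rewrite -resid_mkseq kmin.
  - have rE : g n - fourier ip e (g n) n = c^-1 *: e n.
      by rewrite enE -kn resid_mkseq scalerA mulVf// scale1r.
    have gn : ip (g n) (e n) = c^-1.
      rewrite -[g n](subrK (fourier ip e (g n) n)) (ipDl H).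
      by rewrite (fourier_ip H _ _ _ oes) ltnn rE (ipZl H) oe eqxx mulr1 addr0.
    by rewrite fS gn -rE addrC subrK.
exists e => // u ue; apply: gtotal => k; rewrite (kill k.+1 k (ltnSn k)) (ip_sumr H) big1// => i _.
by rewrite (ipZr H) ue mulr0.
Qed.

End gram_schmidt.

Lemma eigenvalue_series (K : V -> V) (e : nat -> V) (tau M : R) (l : nat -> R[i]) :
  linear K -> (forall u v, ip (K u) v = ip u (K v)) ->
  (forall u, 0 <= Re (ip (K u) u)) -> (forall u, Re (ip (K u) u) <= M * sq u) ->
  orthonormal ip e -> total ip e ->
  series (fun k => Re (ip (K (e k)) (e k))) @ \oo --> tau ->
  (forall z, z != 0 -> counting [set i | l i = z] =
    ereal_sup [set (n%:R%:E : \bar R) | n in [set n | exists b : 'I_n -> V,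
      (forall c : 'I_n -> R[i], \sum_(i < n) c i *: b i = 0 -> forall i, c i = 0) /\
      forall i, exists k, iter k (fun v => K v - z *: v) (b i) = 0]]) ->
  (forall i, Im (l i) = 0) /\ series (fun i => Re (l i)) @ \oo --> tau.
Proof.
move=> linK symK K0 KM oe te tr lmult.
have tr_le N : \sum_(k < N) Re (ip (K (e k)) (e k)) <= tau.
  rewrite -(big_mkord xpredT (fun k => Re (ip (K (e k)) (e k)))).
  have /nondecreasing_cvgn_le : nondecreasing_seq (series (fun k => Re (ip (K (e k)) (e k)))).
    by apply: nondecreasing_series.
  move=> /(_ (cvgP _ tr) N).
  by rewrite (cvg_lim _ tr).
have [v [ov Kv lv vmax]] := eigenvector_listing linK symK K0 oe te tr_le lmult.
split => [i|].
  by have := congr1 Im (listed_eigenvalue_real H symK ov Kv lv i); rewrite cImJ; lra.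
have lge0 := listed_eigenvalue_ge0 H symK K0 ov Kv lv.
have sum_le := listed_eigenvalues_sum_le H linK symK K0 oe te tr_le ov Kv lv.
apply/cvgrPdist_le => eps eps0.
have [N _ hN] := (cvgrPdist_le _ _).1 tr (eps / 2) ltac:(lra).
have [n hn] := listed_eigenvalues_sum_ge H linK symK K0 KM oe te tr_le ov Kv lv vmax
  (ltac:(lra) : 0 < eps / 2) N.
exists n => // m /= nm; rewrite /series/= big_mkord ger0_norm ?subr_ge0//.
have := hN N (leqnn _); rewrite /series/= big_mkord ger0_norm ?subr_ge0//.
have : \sum_(i < n) Re (l i) <= \sum_(i < m) Re (l i).
  by rewrite -(subnKC nm) big_split_ord/= lerDl sumr_ge0.
lra.
Qed.

End inner_product.

(** * Completeness of L^2 *)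

Section riesz_fischer.
Context d (T : measurableType d) (R : realType) (mu : {measure set T -> \bar R}).
Local Open Scope ereal_scope.

Lemma limn_einf_ge0 (u : (\bar R)^nat) : (forall n, 0 <= u n) -> 0 <= limn_einf u.
Proof.
move=> u0; rewrite limn_einf_lim; apply: lime_ge; first exact: is_cvg_einfs.
by apply: nearW => n; apply: le_ereal_inf_tmp => _ [k _ <-].
Qed.

Lemma limn_einf_le (u : (\bar R)^nat) c N : (forall n, (N <= n)%N -> u n <= c) ->
  limn_einf u <= c.
Proof.
move=> uc; rewrite limn_einf_lim; apply: lime_le; first exact: is_cvg_einfs.
exists N => // n /= Nn; apply: le_trans (uc n Nn); apply: ereal_inf_lbound.
by exists n => /=.
Qed.

Lemma measurable_fun_limn_einf (f : (T -> \bar R)^nat) :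
  (forall n, measurable_fun setT (f n)) ->
  measurable_fun setT (fun x => limn_einf (f ^~ x)).
Proof.
move=> mf; apply: measurableT_comp => //.
by apply: measurable_fun_limn_esup => n; exact: measurableT_comp.
Qed.

Lemma square_cauchy_cvg (g : nat -> R) (C : R) :
  (forall k, (4 ^+ k * (g k.+1 - g k) ^+ 2 <= C)%R) -> cvgn g.
Proof.
move=> gC.
have C0 : (0 <= C)%R by apply: le_trans (gC 0%N); rewrite mulr_ge0 ?sqr_ge0// exprn_ge0.
have gE : g = (fun k => g 0%N + series (fun k => g k.+1 - g k) k)%R.
  by apply/funext => k; rewrite /series/= telescope_sumr// addrC subrK.
rewrite gE; apply: is_cvgD; first exact: is_cvg_cst.
(* [C + 1] bounds the square root of [C], so the increments are dominated by [(C + 1) 2^-k]. *)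
apply: normed_cvg; apply: (@series_le_cvg _ _ (geometric (C + 1) 2^-1)%R) => [k|k|k|].
- by rewrite /= normr_ge0.
- by rewrite /geometric/= mulr_ge0 ?addr_ge0// exprn_ge0.
- rewrite /geometric/= exprVn ler_pdivlMr ?exprn_gt0//.
  have C1 : (0 <= C + 1)%R by rewrite addr_ge0.
  rewrite -(@ler_pXn2r _ 2)// ?nnegrE// ?mulr_ge0 ?exprn_ge0//.
  rewrite exprMn -exprM mulnC exprM.
  have -> : (2 ^+ 2 = 4 :> R)%R by ring.
  rewrite real_normK ?num_real// mulrC (le_trans (gC k))//.
  by rewrite expr2; nra.
- by apply: is_cvg_geometric_series; rewrite ger0_norm// invf_lt1// ltr1n.
Qed.

(** Along a fast subsequence the weighted sum [F] of squared increments is integrable, hence finite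
    almost everywhere, which forces pointwise convergence; Fatou's lemma then gives the bound for
    the whole sequence. *)
Lemma riesz_fischer (f : nat -> T -> R) :
  (forall n, measurable_fun setT (f n)) ->
  (forall eps : R, (0 < eps)%R -> exists N, forall m n, (N <= m)%N -> (N <= n)%N ->
    \int[mu]_x ((f m x - f n x) ^+ 2)%:E < eps%:E) ->
  exists phi : T -> R, measurable_fun setT phi /\
    forall eps : R, (0 < eps)%R -> exists N, forall n, (N <= n)%N ->
      \int[mu]_x ((f n x - phi x) ^+ 2)%:E <= eps%:E.
Proof.
move=> mf cf.
(* The factor [4^-k] cancels the weight in [G], and [2^-(k+1)] makes the integrals of [G k]
   summable. *)
pose e k : R := ((4 ^+ k)^-1 * (1 / (2 ^ k.+1)%:R))%R.
have e0 k : (0 < e k)%R by rewrite mulr_gt0 ?invr_gt0 ?exprn_gt0// divr_gt0 ?ltr0n ?expn_gt0.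
have [N hN] := choice (fun k => cf (e k) (e0 k)).
(* Both [nu k] and [nu k.+1] are at least [N k], so the Cauchy bound applies to consecutive terms;
   the summand [k] gives [nu k >= k] for the final use of Fatou's lemma. *)
pose nu (k : nat) := (k + \sum_(i < k.+1) N i)%N.
have nuN k : (N k <= nu k)%N.
  by rewrite /nu big_ord_recr/= addnA leq_addl.
have nuS k : (N k <= nu k.+1)%N.
  apply: leq_trans (leq_addl _ _); rewrite 2!big_ord_recr/=.
  by apply: leq_trans (leq_addr _ _); exact: leq_addl.
pose g k := f (nu k).
have msq (a b : T -> R) : measurable_fun setT a -> measurable_fun setT b ->
    measurable_fun setT (fun x => ((a x - b x) ^+ 2)%:E).
  by move=> ma mb; apply/measurable_EFinP/measurable_funX/measurable_funB.
pose G k x := (4 ^+ k * (g k.+1 x - g k x) ^+ 2)%:E.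
have mG k : measurable_fun setT (G k).
  apply/measurable_EFinP; apply: measurable_funM => //.
  by apply/measurable_funX/measurable_funB; exact: mf.
have G0 k x : 0 <= G k x by rewrite lee_fin; apply: mulr_ge0; [exact: exprn_ge0|exact: sqr_ge0].
pose F x := \sum_(0 <= k <oo) G k x.
have intF : mu.-integrable setT F.
  apply/integrableP; split.
    by apply: ge0_emeasurable_sum => // k x _ _; exact: G0.
  rewrite (_ : \int[mu]_x _ = \int[mu]_x F x); last first.
    by apply: eq_integral => x _; rewrite gee0_abs// nneseries_ge0// => k _ _; exact: G0.
  rewrite integral_nneseries//.
  apply: (@le_lt_trans _ _ (\sum_(0 <= k <oo) (1 / (2 ^ k.+1)%:R)%:E)).
    apply: lee_nneseries => k _; first by move=> _; exact: integral_ge0.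
    have -> : \int[mu]_x G k x =
        (4 ^+ k)%:E * \int[mu]_x ((g k.+1 x - g k x) ^+ 2)%:E.
      rewrite -ge0_integralZl//; first by apply: msq; exact: mf.
      by move=> x _; rewrite lee_fin sqr_ge0.
    rewrite -lee_pdivlMl ?exprn_gt0// -EFinM.
    by apply/ltW/hN.

  exact: le_lt_trans (epsilon_trick0 xpredT (@ler01 R)) (ltry _).
have aeF := integrable_ae measurableT intF.
have Gcvg x : F x \is a fin_num -> cvgn (g ^~ x).
  move=> Fx; apply: (@square_cauchy_cvg _ (fine (F x))) => k.
  rewrite -lee_fin fineK// -/(G k x).
  apply: le_trans (nneseries_lim_ge k.+1 _) => //.
  by rewrite big_nat_recr//= leeDr// sume_ge0.
(* A limit superior is measurable everywhere; the default value of [fine] can occur only where [F]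
   is infinite, on a null set. *)
pose phi x := fine (limn_esup (fun k => (g k x)%:E)).
have phiP x : F x \is a fin_num -> g ^~ x @ \oo --> phi x.
  move=> /Gcvg/cvg_ex[l gl]; rewrite /phi.
  have -> : limn_esup (fun k => (g k x)%:E) = l%:E.
    apply: (cvg_limn_einf_sup _).2; apply: cvg_EFin; [exact: nearW|exact: gl].
  exact: gl.
have mphi : measurable_fun setT phi.
  apply: measurableT_comp => //.
  by apply: measurable_fun_limn_esup => n; exact/measurable_EFinP/mf.
exists phi; split => // eps eps0; have [M hM] := cf eps eps0.
exists M => n Mn.
have -> : \int[mu]_x ((f n x - phi x) ^+ 2)%:E =
    \int[mu]_x limn_einf (fun k => ((f n x - g k x) ^+ 2)%:E).
  apply: ge0_ae_eq_integral => //.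
  - exact: msq.
  - by apply: measurable_fun_limn_einf => k; apply: msq; exact: mf.
  - by move=> x _; rewrite lee_fin sqr_ge0.
  - by move=> x _; apply: limn_einf_ge0 => k; rewrite lee_fin sqr_ge0.
  - apply: filterS aeF => x /(_ I) /phiP gx _; apply/esym.
    apply: (cvg_limn_einf_sup _).1; apply: cvg_EFin; first exact: nearW.
    have fg : (f n x - g k x)%R @[k --> \oo] --> (f n x - phi x)%R.
      by apply: cvgB => //; exact: cvg_cst.
    exact: (cvgM fg fg).
apply: le_trans (fatou _ _ _ _) _ => //.
- by move=> k; apply: msq; exact: mf.
- by move=> k x _; rewrite lee_fin sqr_ge0.
apply: (limn_einf_le (N := M)) => k Mk; apply/ltW/hM => //.
by rewrite /nu (leq_trans Mk)// leq_addr.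
Qed.

Lemma Lfun2_sqr_lty (f : T -> R) : measurable_fun setT f ->
  \int[mu]_x (f x ^+ 2)%:E < +oo -> f \in Lfun mu 2%:E.
Proof.
move=> mf f2; apply/andP; split; apply/mem_set => //=.
rewrite /finite_norm unlock /Lnorm; apply: poweR_lty.
by under eq_integral do rewrite /= powR_mulrn// real_normK ?num_real//.
Qed.

End riesz_fischer.

Local Open Scope quotient_scope.

Section L2_hilbert.
Context d (T : measurableType d) (R : realType) (mu : {measure set T -> \bar R}).

Lemma L2_fun_Re (f : L2_fun mu) : Re \o f \in Lfun mu 2%:E.
Proof. by case: f => f /= /andP[]. Qed.

Lemma L2_fun_Im (f : L2_fun mu) : Im \o f \in Lfun mu 2%:E.
Proof. by case: f => f /= /andP[]. Qed.

Lemma Lfun_measurable (p : \bar R) (f : T -> R) : f \in Lfun mu p -> measurable_fun setT f.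
Proof. by move=> /andP[/set_mem]. Qed.

Lemma Lfun2_mul_integrable (f g : T -> R) : f \in Lfun mu 2%:E -> g \in Lfun mu 2%:E ->
  mu.-integrable setT (fun x => (f x * g x)%:E).
Proof. by move=> Lf Lg; apply/Lfun1_integrable; exact: Lfun2_mul_Lfun1. Qed.

Lemma cintegrable_mul (f g : L2_fun mu) : cintegrable mu setT (fun x => f x * ((g x)^*)%R).
Proof.
have Rf := L2_fun_Re f; have If := L2_fun_Im f.
have Rg := L2_fun_Re g; have Ig := L2_fun_Im g.
split.
- have := integrableD measurableT (Lfun2_mul_integrable Rf Rg) (Lfun2_mul_integrable If Ig).
  apply: eq_integrable => // x _.
  by rewrite cReM cReJ cImJ mulrN opprK.
- have := integrableB measurableT (Lfun2_mul_integrable If Rg) (Lfun2_mul_integrable Rf Ig).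
  apply: eq_integrable => // x _.
  by rewrite cImM cReJ cImJ mulrN EFinD addeC EFinN.
Qed.

Lemma cintegralD (f g : T -> R[i]) : cintegrable mu setT f -> cintegrable mu setT g ->
  cintegral mu setT (fun x => f x + g x) = cintegral mu setT f + cintegral mu setT g.
Proof.
move=> [rf mf] [rg mg]; apply: complex_eqP => /=.
  by rewrite -RintegralD//; apply: eq_Rintegral => x _; exact: cReD.
by rewrite -RintegralD//; apply: eq_Rintegral => x _; exact: cImD.
Qed.

Lemma cintegralZ (a : R[i]) (f : T -> R[i]) : cintegrable mu setT f ->
  cintegral mu setT (fun x => a * f x) = a * cintegral mu setT f.
Proof.
move=> [rf mf]; have Zint (c : R) (h : T -> R) : mu.-integrable setT (EFin \o h) ->
    mu.-integrable setT (EFin \o (fun x => c * h x)) by exact: integrableZl.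
apply: complex_eqP; rewrite ?cReM ?cImM /= -!RintegralZl//.
  rewrite -RintegralB//; [|exact: Zint..].
  by apply: eq_Rintegral => x _; exact: cReM.
rewrite -RintegralD//; [|exact: Zint..].
by apply: eq_Rintegral => x _; exact: cImM.
Qed.

Lemma cintegralJ (f : T -> R[i]) : cintegrable mu setT f ->
  cintegral mu setT (fun x => ((f x)^*)%R) = ((cintegral mu setT f)^*)%R.
Proof.
move=> [rf mf]; apply: complex_eqP; rewrite ?cReJ ?cImJ /=.
  by apply: eq_Rintegral => x _; exact: cReJ.
rewrite -mulN1r -RintegralZl//.
by apply: eq_Rintegral => x _; rewrite cImJ mulN1r.
Qed.

Lemma ae_eq_cintegral (f g : T -> R[i]) : cintegrable mu setT f -> cintegrable mu setT g ->
  f = g %[ae mu] -> cintegral mu setT f = cintegral mu setT g.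
Proof.
move=> [/measurable_int rf /measurable_int mf] [/measurable_int rg /measurable_int mg] fg.
apply: complex_eqP => /=; congr fine; apply: ae_eq_integral => //.
  by apply: filterS fg => x fgx Dx; rewrite fgx.
by apply: filterS fg => x fgx Dx; rewrite fgx.
Qed.

Lemma inner_pi (f g : L2_fun mu) : inner (\pi_(L2 mu) f) (\pi_(L2 mu) g) =
  cintegral mu setT (fun x => f x * ((g x)^*)%R).
Proof.
apply: ae_eq_cintegral; [exact: cintegrable_mul..|].
by apply: filterS2 (L2_reprE f) (L2_reprE g) => x fx gx Dx; rewrite fx// gx.
Qed.

Lemma L2_piD (f g : L2_fun mu) : \pi_(L2 mu) f + \pi_(L2 mu) g = \pi_(L2 mu) (f + g).
Proof. exact: pi_L2_add. Qed.

Lemma L2_piB (f g : L2_fun mu) : \pi_(L2 mu) f - \pi_(L2 mu) g = \pi_(L2 mu) (f - g).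
Proof. by rewrite -L2_piD; congr (_ + _); exact: pi_L2_opp. Qed.

Lemma L2_piZ a (f : L2_fun mu) : a *: \pi_(L2 mu) f = \pi_(L2 mu) (a *: f).
Proof. exact: pi_L2_scale. Qed.

Lemma sqlen_pi (f : L2_fun mu) : ((sqlen (@inner _ _ _ mu) (\pi_(L2 mu) f))%:E =
  \int[mu]_x (Re (f x) ^+ 2)%:E + \int[mu]_x (Im (f x) ^+ 2)%:E)%E.
Proof.
have Rf := Lfun2_integrable_sqr (L2_fun_Re f).
have If := Lfun2_integrable_sqr (L2_fun_Im f).
rewrite -integralD// /sqlen inner_pi /=.
rewrite (_ : \int[mu]_x Re _ = \int[mu]_x (Re (f x) ^+ 2 + Im (f x) ^+ 2)); last first.
  by apply: eq_Rintegral => x _; rewrite cReM cReJ cImJ mulrN opprK.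
rewrite /Rintegral fineK; first by apply: eq_integral => x _; rewrite EFinD.
apply: integrable_fin_num => //; have := integrableD measurableT Rf If.
by apply: eq_integrable => // x _; rewrite EFinD.
Qed.

Lemma L2_inner_complete (u : nat -> L2 mu) :
  (forall eps : R, 0 < eps -> exists N, forall m n, (N <= m)%N -> (N <= n)%N ->
    sqlen (@inner _ _ _ mu) (u m - u n) < eps) ->
  exists l, forall eps : R, 0 < eps -> exists N, forall n, (N <= n)%N ->
    sqlen (@inner _ _ _ mu) (u n - l) < eps.
Proof.
move=> cu; pose f n : L2_fun mu := repr (u n).
have uE n : u n = \pi_(L2 mu) (f n) by rewrite reprK.
have cau (part : R[i] -> R) :
    (forall a b, part (a - b) = part a - part b) ->
    (forall g : L2_fun mu, (\int[mu]_x (part (g x) ^+ 2)%:E <=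
        (sqlen (@inner _ _ _ mu) (\pi_(L2 mu) g))%:E)%E) ->
    forall eps : R, 0 < eps -> exists N, forall m n, (N <= m)%N -> (N <= n)%N ->
      (\int[mu]_x ((part (f m x) - part (f n x)) ^+ 2)%:E < eps%:E)%E.
  move=> partB part_le eps /cu[N hN]; exists N => m n Nm Nn.
  have := hN m n Nm Nn; rewrite -lte_fin !uE L2_piB; apply: le_lt_trans.
  apply: le_trans (part_le _); rewrite le_eqVlt; apply/orP; left; apply/eqP; apply: eq_integral => x _.
  by rewrite -partB.
have Re_le (g : L2_fun mu) : (\int[mu]_x (Re (g x) ^+ 2)%:E <=
    (sqlen (@inner _ _ _ mu) (\pi_(L2 mu) g))%:E)%E.
  by rewrite sqlen_pi leeDl// integral_ge0// => x _; rewrite lee_fin sqr_ge0.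
have Im_le (g : L2_fun mu) : (\int[mu]_x (Im (g x) ^+ 2)%:E <=
    (sqlen (@inner _ _ _ mu) (\pi_(L2 mu) g))%:E)%E.
  by rewrite sqlen_pi leeDr// integral_ge0// => x _; rewrite lee_fin sqr_ge0.
have ReB (a b : R[i]) : Re (a - b) = Re a - Re b by rewrite cReD cReN.
have ImB (a b : R[i]) : Im (a - b) = Im a - Im b by rewrite cImD cImN.
have mRe n := Lfun_measurable (L2_fun_Re (f n)).
have mIm n := Lfun_measurable (L2_fun_Im (f n)).
have [phi [mphi hphi]] := riesz_fischer mRe (cau _ ReB Re_le).
have [psi [mpsi hpsi]] := riesz_fischer mIm (cau _ ImB Im_le).
have p1 : (1 <= 2%:E :> \bar R)%E by rewrite lee_fin ler1n.
(* [riesz_fischer] only provides a measurable limit; it is square-integrable as the difference of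
   [g N] and [g N - h]. *)
have lim_L2 (g : nat -> T -> R) (h : T -> R) : (forall n, g n \in Lfun mu 2%:E) ->
    measurable_fun setT h ->
    (forall eps : R, 0 < eps -> exists N, forall n, (N <= n)%N ->
      (\int[mu]_x ((g n x - h x) ^+ 2)%:E <= eps%:E)%E) -> h \in Lfun mu 2%:E.
  move=> Lg mh /(_ 1 ltr01)[N /(_ N (leqnn N)) hN].
  have Lgh : (g N - h)%R \in Lfun mu 2%:E.
    apply: Lfun2_sqr_lty; last by apply: le_lt_trans hN _; rewrite ltry.
    by apply: measurable_funB => //; exact: Lfun_measurable (Lg N).
  have := (Lfun_submod_closed mu p1).2 (-1) _ _ Lgh (Lg N).
  by rewrite scaleN1r opprB subrK.
have Lh : (fun x => phi x +i* psi x) \in L2_pred mu.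
  apply/andP; split.
    exact: (lim_L2 (fun n => Re \o f n) phi (fun n => L2_fun_Re (f n))).
  exact: (lim_L2 (fun n => Im \o f n) psi (fun n => L2_fun_Im (f n))).
pose h := L2_Fun Lh; exists (\pi_(L2 mu) h) => eps eps0.
have [N1 h1] := hphi (eps / 3) ltac:(lra).
have [N2 h2] := hpsi (eps / 3) ltac:(lra).
exists (maxn N1 N2) => n; rewrite geq_max => /andP[/h1 {}h1 /h2 {}h2].
rewrite -lte_fin uE L2_piB sqlen_pi.
apply: (@le_lt_trans _ _ ((eps / 3)%:E + (eps / 3)%:E)%E); last by rewrite -EFinD lte_fin; lra.
apply: leeD; [apply: le_trans h1|apply: le_trans h2].
  by rewrite le_eqVlt; apply/orP; left; apply/eqP; apply: eq_integral => x _; rewrite ReB.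
by rewrite le_eqVlt; apply/orP; left; apply/eqP; apply: eq_integral => x _; rewrite ImB.
Qed.

Lemma inner_hilbert : hilbert_product (@inner _ _ _ mu).
Proof.
split.
- elim/quotW=> f; elim/quotW=> g; elim/quotW=> h.
  rewrite L2_piD !inner_pi -cintegralD; [|exact: cintegrable_mul..].
  by congr cintegral; apply/funext => x; rewrite mulrDl.
- move=> a; elim/quotW=> f; elim/quotW=> g.
  rewrite L2_piZ !inner_pi -cintegralZ; last exact: cintegrable_mul.
  by congr cintegral; apply/funext => x; rewrite mulrA.
- elim/quotW=> f; elim/quotW=> g.
  rewrite !inner_pi -cintegralJ; last exact: cintegrable_mul.
  by congr cintegral; apply/funext => x; rewrite rmorphM/= conjCK mulrC.
- elim/quotW=> f; rewrite -lee_fin sqlen_pi adde_ge0// integral_ge0// => x _;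
    by rewrite lee_fin sqr_ge0.
- elim/quotW=> f f0; have := congr1 EFin f0; rewrite sqlen_pi => /eqP.
  have I0 (g : T -> R) : (0 <= \int[mu]_x (g x ^+ 2)%:E)%E.
    by apply: integral_ge0 => x _; rewrite lee_fin sqr_ge0.
  have Z (g : T -> R) : measurable_fun setT g ->
      (\int[mu]_x (g x ^+ 2)%:E = 0)%E -> g = cst 0 %[ae mu].
    move=> mg g0; have g0' : (\int[mu]_x `|(g x ^+ 2)%:E| = 0)%E.
      by rewrite -g0; apply: eq_integral => x _; rewrite gee0_abs// lee_fin sqr_ge0.
    have mg2 : measurable_fun setT (fun x => (g x ^+ 2)%:E).
      by apply/measurable_EFinP; exact: measurable_funX.
    have := (ae_eq_integral_abs mu measurableT mg2).1 g0'.
    apply: filterS => x /= h Dx; have [/eqP] := h Dx.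
    by rewrite sqrf_eq0 => /eqP.
  have mRe := Lfun_measurable (L2_fun_Re f); have mIm := Lfun_measurable (L2_fun_Im f).
  rewrite padde_eq0// => /andP[/eqP/(Z _ mRe) r0 /eqP/(Z _ mIm) i0].
  rewrite -[RHS]/(\pi_(L2 mu) 0); apply: L2_eqP.
  apply: filterS2 r0 i0 => x /= rx ix Dx; apply: complex_eqP; [exact: rx|exact: ix].
- exact: L2_inner_complete.
Qed.

End L2_hilbert.

(** * Measure-preserving maps and time-frequency shifts *)

Definition measure_preserving d (T : measurableType d) (R : realType)
    (mu : {measure set T -> \bar R}) (s : T -> T) :=
  measurable_fun setT s /\ forall A, measurable A -> mu (s @^-1` A) = mu A.

Lemma lebesgue_measure_shift (R : realType) (a : R) :
  measure_preserving (@lebesgue_measure R) (fun t : measurableTypeR R => t - a).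
Proof.
have ms : measurable_fun setT (fun t : measurableTypeR R => t - a : measurableTypeR R).
  by apply: measurable_funB => //; exact: measurable_cst.
split => // A mA.
pose m : {measure set (measurableTypeR R) -> \bar R} :=
  measure_function_pushforward__canonical__measure_function_Measure lebesgue_measure ms.
apply/esym; apply: (@lebesgue_measure_unique R m) => // X /ocitvP[->|[[x y] /= xy ->]].
  by rewrite !measure0.
rewrite /m/= /pushforward.
have -> : (fun t => t - a) @^-1` `]x, y] = `]x + a, y + a]%classic.
  by apply/seteqP; split => t /=; rewrite !in_itv/= ltrBrDr lerBlDr.
rewrite !lebesgue_measure_itv/= !lte_fin xy ltrD2r xy -!EFinB.
by congr EFin; ring.
Qed.

Lemma measure_preserving_prod d1 d2 (T1 : measurableType d1) (T2 : measurableType d2)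
    (R : realType) (m1 : {sigma_finite_measure set T1 -> \bar R})
    (m2 : {sigma_finite_measure set T2 -> \bar R}) (s1 : T1 -> T1) (s2 : T2 -> T2) :
  measure_preserving m1 s1 -> measure_preserving m2 s2 ->
  measure_preserving (m1 \x m2)%E (fun p : T1 * T2 => (s1 p.1, s2 p.2)).
Proof.
move=> [ms1 s1p] [ms2 s2p]; set s12 := fun p : T1 * T2 => _.
have ms12 : measurable_fun [set: T1 * T2] (s12 : (T1 * T2)%type -> (T1 * T2)%type).
  by apply: measurable_fun_pair; exact: measurableT_comp.
split => // A mA.
pose m : {measure set (T1 * T2)%type -> \bar R} :=
  measure_function_pushforward__canonical__measure_function_Measure (m1 \x m2)%E ms12.
apply/esym; apply: (@product_measure_unique _ _ _ _ _ m1 m2 m) => // B C mB mC.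
rewrite /m/= /pushforward.
have -> : s12 @^-1` (B `*` C) = (s1 @^-1` B) `*` (s2 @^-1` C) by [].
rewrite product_measure1E ?s1p ?s2p//.
- by rewrite -[X in measurable X]setTI; exact: ms1.
- by rewrite -[X in measurable X]setTI; exact: ms2.
Qed.

Lemma lebesgue_n_shift (R : realType) n (x : Rn R n) :
  measure_preserving (lebesgue_n R n)
    (fun t => [tuple tnth t i - tnth x i | i < n]).
Proof.
elim: n x => [|n ih] x; set s := (fun t : Rn R _ => _);
  have ms : measurable_fun setT s.
- by apply/measurable_fun_tnthP => -[].
- by split => // A mA; congr (lebesgue_n R 0 _); apply/seteqP; split => t /=;
    rewrite (_ : s t = t)// (tuple0 t); exact: tuple0.
- apply/measurable_fun_tnthP => i /=.
  rewrite (_ : _ \o _ = fun t => tnth t i - tnth x i).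
    by apply: measurable_funB; [exact: measurable_tnth|exact: measurable_cst].
  by apply/funext => t /=; rewrite tnth_mktuple.
split => // A mA.
pose s1 := (fun t : measurableTypeR R => t - thead x : measurableTypeR R).
pose s2 := (fun t : Rn R n => [tuple tnth t i - tnth [tuple of behead x] i | i < n] : Rn R n).
have [ms12 s12p] : measure_preserving (@lebesgue_measure R \x lebesgue_n R n)%E
    (fun p => (s1 p.1, s2 p.2)).
  by apply: measure_preserving_prod; [exact: lebesgue_measure_shift|exact: ih].
(* [tcons] intertwines the shift in dimension [n + 1] with the product of a shift of the line and a
   shift in dimension [n]. *)
have scons (p : measurableTypeR R * Rn R n) : s (tcons p) = tcons (s1 p.1, s2 p.2).
  apply: eq_from_tnth => i; rewrite tnth_mktuple.
  case: (unliftP ord0 i) => [j ->|->]; last by rewrite !tnth0.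
  rewrite !tnthS tnth_mktuple tnth_behead; congr (_ - tnth _ _).
  by apply: val_inj; rewrite /= ?inordK ?ltnS.
pose tc := @tcons _ (measurableTypeR R) n.
have mA' : measurable (tc @^-1` A).
  by rewrite -[X in measurable X]setTI; exact: measurable_tcons.
have := s12p _ mA'; rewrite /= /tuple_measure_cons /pushforward => <-.
by congr (_ _); apply/seteqP; split => p; rewrite /preimage /tc /= scons.
Qed.

(** * Composition with a measure-preserving map, times a unimodular factor *)

Section twist.
Context d (T : measurableType d) (R : realType) (mu : {measure set T -> \bar R}).
Variables (s : T -> T) (c : T -> R[i]).
Hypothesis sP : measure_preserving mu s.
Hypothesis mcRe : measurable_fun setT (Re \o c).
Hypothesis mcIm : measurable_fun setT (Im \o c).
Hypothesis c1 : forall t, sqnorm (c t) = 1.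

Let ms := sP.1.

Lemma preserving_integral (f : T -> \bar R) : measurable_fun setT f ->
  (forall x, 0 <= f x)%E -> (\int[mu]_x f (s x) = \int[mu]_x f x)%E.
Proof.
move=> mf f0.
pose m : {measure set T -> \bar R} :=
  measure_function_pushforward__canonical__measure_function_Measure mu ms.
rewrite -[LHS](ge0_integral_pushforward ms mu measurableT mf)//.
by apply: (eq_measure_integral mu (m1 := m)) => A mA _; exact: sP.2.
Qed.

Lemma preserving_Rintegral (f : T -> R) : mu.-integrable setT (EFin \o f) ->
  mu.-integrable setT (EFin \o (f \o s)) /\ \int[mu]_x f (s x) = \int[mu]_x f x.
Proof.
move=> /integrableP[mf fi].
have fsi : mu.-integrable setT (EFin \o (f \o s)).
  apply/integrableP; split; first exact: measurableT_comp mf ms.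
  by rewrite (preserving_integral (f := fun x => `|(f x)%:E|%E))//; exact: measurableT_comp.
split => //; rewrite /Rintegral; congr fine.
pose m : {measure set T -> \bar R} :=
  measure_function_pushforward__canonical__measure_function_Measure mu ms.
rewrite -[LHS](integral_pushforward ms mf fsi measurableT).
by apply: (eq_measure_integral mu (m1 := m)) => A mA _; exact: sP.2.
Qed.

Lemma preserving_ae (P : set T) : {ae mu, forall x, P x} -> {ae mu, forall x, P (s x)}.
Proof.
case=> N [mN N0 PN]; exists (s @^-1` N); split.
- by rewrite -[X in measurable X]setTI; exact: ms.
- by rewrite sP.2.
- by move=> x /= nP; apply: PN.
Qed.

Let twist_L2 (f : L2_fun mu) : (fun t => c t * f (s t)) \in L2_pred mu.
Proof.
have mRe := Lfun_measurable (L2_fun_Re f); have mIm := Lfun_measurable (L2_fun_Im f).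
have mRes : measurable_fun setT (fun t => Re (f (s t))) := measurableT_comp mRe ms.
have mIms : measurable_fun setT (fun t => Im (f (s t))) := measurableT_comp mIm ms.
have mRe' : measurable_fun setT (Re \o (fun t => c t * f (s t))).
  rewrite (_ : _ \o _ = fun t => Re (c t) * Re (f (s t)) - Im (c t) * Im (f (s t))).
    by apply: measurable_funB; exact: measurable_funM.
  by apply/funext => t /=; rewrite cReM.
have mIm' : measurable_fun setT (Im \o (fun t => c t * f (s t))).
  rewrite (_ : _ \o _ = fun t => Re (c t) * Im (f (s t)) + Im (c t) * Re (f (s t))).
    by apply: measurable_funD; exact: measurable_funM.
  by apply/funext => t /=; rewrite cImM.
pose F x := ((Re (f x)) ^+ 2 + (Im (f x)) ^+ 2)%:E.
have mF : measurable_fun setT F.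
  by apply/measurable_EFinP; apply: measurable_funD; exact: measurable_funX.
have Ffin : (\int[mu]_x F (s x) < +oo)%E.
  rewrite preserving_integral//; last by move=> x; rewrite lee_fin addr_ge0// sqr_ge0.
  rewrite (_ : \int[mu]_x F x = (sqlen (@inner _ _ _ mu) (\pi_(L2 mu) f))%:E)%E ?ltry//.
  rewrite sqlen_pi -ge0_integralD//.
  - by move=> x _; rewrite lee_fin sqr_ge0.
  - by apply/measurable_EFinP; exact: measurable_funX.
  - by move=> x _; rewrite lee_fin sqr_ge0.
  - by apply/measurable_EFinP; exact: measurable_funX.
have sumsq t : Re (c t * f (s t)) ^+ 2 + Im (c t * f (s t)) ^+ 2 =
    (Re (f (s t))) ^+ 2 + (Im (f (s t))) ^+ 2.
  by have := sqnormM (c t) (f (s t)); rewrite c1 mul1r.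
apply/andP; split; apply: Lfun2_sqr_lty => //; apply: le_lt_trans Ffin;
  apply: ge0_le_integral => //.
- by move=> x _; rewrite lee_fin sqr_ge0.
- by apply/measurable_EFinP; exact: measurable_funX.
- exact: (measurableT_comp mF ms).
- by move=> t _; rewrite lee_fin -sumsq lerDl sqr_ge0.
- by move=> x _; rewrite lee_fin sqr_ge0.
- by apply/measurable_EFinP; exact: measurable_funX.
- exact: (measurableT_comp mF ms).
- by move=> t _; rewrite lee_fin -sumsq lerDr sqr_ge0.
Qed.

(** General enough to give both a time-frequency shift and its inverse. *)
Definition twist (f : L2_fun mu) : L2_fun mu := L2_Fun (twist_L2 f).

Lemma inner_twist (f g : L2_fun mu) :
  inner (\pi_(L2 mu) (twist f)) (\pi_(L2 mu) (twist g)) =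
  inner (\pi_(L2 mu) f) (\pi_(L2 mu) g).
Proof.
rewrite !inner_pi; have [ir ii] := cintegrable_mul f g.
transitivity (cintegral mu setT (fun x => f (s x) * ((g (s x))^*)%R)).
  congr cintegral; apply/funext => x /=; rewrite rmorphM/= mulrACA.
  by rewrite mul_conj_sqnorm c1 mul1r.
by apply: complex_eqP => /=; [rewrite -(preserving_Rintegral ir).2|rewrite -(preserving_Rintegral ii).2].
Qed.

Lemma twist_ae (f g : L2_fun mu) : f = g %[ae mu] -> twist f = twist g %[ae mu].
Proof.
by move=> /preserving_ae; apply: filterS => x /= fg Dx; rewrite fg.
Qed.

Lemma L2_class_twist (f : L2_fun mu) :
  L2_class mu (fun t => c t * f (s t)) = \pi_(L2 mu) (twist f).
Proof.
rewrite /L2_class; case: insubP => [g _ gE|]; last by rewrite twist_L2.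
by congr (\pi_(L2 mu) _); apply: val_inj.
Qed.

End twist.

(** * Adjoints of symmetric and of unitary operators; bounded forms *)

Section adjoints.
Context d (T : measurableType d) (R : realType) (mu : {measure set T -> \bar R}).
Local Notation H := (L2 mu).
Local Notation HH := (inner_hilbert mu).

Lemma inner_nondegenerate (v : H) : (forall w, inner w v = 0) -> v = 0.
Proof. by move=> v0; apply: (sqlen_eq0 HH); rewrite /sqlen v0. Qed.

(** [adjoint] chooses some operator with the defining identity. [A] itself has it, and nondegeneracy
    of the inner product leaves no other choice. *)
Lemma adjoint_symmetric (A : H -> H) : (forall u v, inner (A u) v = inner u (A v)) ->
  adjoint A = A.
Proof.
move=> symA; rewrite /adjoint.
have := @xgetPex _ (fun=> 0) [set B | forall u v, inner (A u) v = inner u (B v)]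
  (ex_intro _ A symA).
set B := xget _ _ => /= BP; apply/funext => v; apply: subr0_eq.
by apply: inner_nondegenerate => w; rewrite (ipBr HH) -BP symA subrr.
Qed.

Section unitary.
Variable U : H -> H.
Hypothesis isoU : forall u v, inner (U u) (U v) = inner u v.
Hypothesis surjU : forall v, exists u, U u = v.

(** A right inverse of the isometry [U] satisfies the defining identity, so the choice made by
    [adjoint] is not the default. *)
Lemma unitary_adjoint u v : inner (U u) v = inner u (adjoint U v).
Proof.
have [r rP] := choice surjU.
have := @xgetPex _ (fun=> 0) [set B | forall u v, inner (U u) v = inner u (B v)].
by apply; exists r => a b; rewrite -[in LHS](rP b) isoU.
Qed.

Lemma unitary_adjointK v : U (adjoint U v) = v.
Proof.
apply: subr0_eq; apply: inner_nondegenerate => w; have [u <-] := surjU w.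
by rewrite (ipBr HH) isoU -unitary_adjoint subrr.
Qed.

Lemma orthonormal_basis_adjoint (e : nat -> H) :
  orthonormal_basis e -> orthonormal_basis (adjoint U \o e).
Proof.
move=> [oe te]; split => [i j|u ue].
  by rewrite /= -isoU !unitary_adjointK.
apply: (sqlen_eq0 HH); rewrite /sqlen -isoU.
rewrite (te (U u)) ?(ip0l HH)// => n.
by rewrite unitary_adjoint; exact: ue.
Qed.

End unitary.

Lemma bounded_form (A : H -> H) : bounded_operator A ->
  exists M : R, forall u, Re (inner (A u) u) <= M * sqlen (@inner _ _ _ mu) u.
Proof.
move=> [_ [M AM]]; exists `|M| => u.
have su := sqlen_ge0 HH u; have sAu := sqlen_ge0 HH (A u).
have h : sqlen (@inner _ _ _ mu) (A u) <= `|M| ^+ 2 * sqlen (@inner _ _ _ mu) u.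
  rewrite -(sqr_sqrtr su) -[leLHS](sqr_sqrtr sAu) -exprMn.
  rewrite ler_sqr ?nnegrE ?mulr_ge0 ?sqrtr_ge0//.
  by apply: le_trans (AM u) _; rewrite ler_wpM2r ?sqrtr_ge0// ler_norm.
apply: le_trans (ler_norm _) _.
rewrite -(@ler_sqr _ `|_|) ?nnegrE ?mulr_ge0// real_normK ?num_real//.
apply: (@le_trans _ _ (sqnorm (inner (A u) u))); first by rewrite lerDl sqr_ge0.
apply: le_trans (cauchy_schwarz HH _ _) _.
by rewrite exprMn [X in _ <= _ * X]expr2 mulrA ler_wpM2r.
Qed.

End adjoints.

Section tf_shift_unitary.
Context (R : realType) (d : nat) (z : Rn R d * Rn R d).
Local Notation mu := (lebesgue_n R d).

Let s (t : Rn R d) : Rn R d := [tuple tnth t i - tnth z.1 i | i < d].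
(** [s'] and [c'] are the data of the inverse shift: [s'] undoes [s], written as a subtraction to
    fit [lebesgue_n_shift], and [c t * c' (s t)] is the squared modulus of [c t], which is 1. *)
Let s' (t : Rn R d) : Rn R d := [tuple tnth t i - tnth [tuple - tnth z.1 i | i < d] i | i < d].
Let c (t : Rn R d) := expi (2 * pi * \sum_(i < d) tnth z.2 i * tnth t i).
Let c' (t : Rn R d) := ((c (s' t))^*)%R.

Let sP : measure_preserving mu s := lebesgue_n_shift z.1.
Let s'P : measure_preserving mu s' := lebesgue_n_shift _.

Let s'K t : s' (s t) = t.
Proof. by apply: eq_from_tnth => i; rewrite !tnth_mktuple opprK subrK. Qed.

Let mphase : measurable_fun setT (fun t : Rn R d => 2 * pi * \sum_(i < d) tnth z.2 i * tnth t i).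
Proof.
apply: measurable_funM; first exact: measurable_cst.
apply: measurable_sum => i.
by apply: measurable_funM; [exact: measurable_cst|exact: measurable_tnth].
Qed.

Let mcRe : measurable_fun setT (Re \o c).
Proof.
apply: (measurableT_comp _ mphase).
by apply: continuous_measurable_fun; exact: continuous_cos.
Qed.

Let mcIm : measurable_fun setT (Im \o c).
Proof.
apply: (measurableT_comp _ mphase).
by apply: continuous_measurable_fun; exact: continuous_sin.
Qed.

Let c1 t : sqnorm (c t) = 1.
Proof. exact: cos2Dsin2. Qed.

Let mc'Re : measurable_fun setT (Re \o c').
Proof.
rewrite (_ : _ \o _ = (Re \o c) \o s'); first exact: measurableT_comp mcRe s'P.1.
by apply/funext => t; exact: cReJ.
Qed.

Let mc'Im : measurable_fun setT (Im \o c').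
Proof.
rewrite (_ : _ \o _ = (fun t => - ((Im \o c) \o s') t)).
  by apply: measurable_funN; exact: measurableT_comp mcIm s'P.1.
by apply/funext => t; exact: cImJ.
Qed.

Let c'1 t : sqnorm (c' t) = 1.
Proof. by rewrite sqnormJ c1. Qed.

Let tf_shiftE u : tf_shift z u = \pi_(L2 mu) (twist sP mcRe mcIm c1 (repr u)).
Proof. exact: (L2_class_twist sP mcRe mcIm c1). Qed.

Lemma tf_shift_isometry u v : inner (tf_shift z u) (tf_shift z v) = inner u v.
Proof. by rewrite !tf_shiftE inner_twist !reprK. Qed.

Lemma tf_shift_surjective v : exists u, tf_shift z u = v.
Proof.
exists (\pi_(L2 mu) (twist s'P mc'Re mc'Im c'1 (repr v))).
rewrite tf_shiftE -[RHS]reprK; apply: L2_eqP.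
have := twist_ae sP mcRe mcIm c1 (L2_reprE (twist s'P mc'Re mc'Im c'1 (repr v))).
apply: filterS => t /= + Dt; move=> ->//.
by rewrite /c' s'K mulrA mul_conj_sqnorm c1 mul1r.
Qed.

End tf_shift_unitary.

(** * Total families of indicators; rational boxes *)

Section indicators.
Context d (T : measurableType d) (R : realType) (mu : {measure set T -> \bar R}).

Lemma pi_system_ae0 (g : nat -> set T) (phi : T -> R) :
  measurable = <<s range g >> -> setI_closed (range g) -> \bigcup_k g k = setT ->
  (forall k, mu.-integrable (g k) (EFin \o phi)) ->
  (forall k, (\int[mu]_(x in g k) (phi x)%:E = 0)%E) -> phi = cst 0 %[ae mu].
Proof.
move=> gen gI gT gint g0.
have mg k : measurable (g k) by rewrite gen; apply: sub_sigma_algebra; exists k.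
(* The Dynkin argument runs inside a fixed [g k], since [phi] is assumed integrable only on these
   sets. *)
have key k A : measurable A -> (\int[mu]_(x in A `&` g k) (phi x)%:E = 0)%E.
  rewrite {1}gen; move: A; apply: (dynkin_induction gen gI).
  - by rewrite setTI.
  - move=> _ [j _ <-]; have [i _ <-] : range g (g j `&` g k).
      by apply: gI; [exists j|exists k].
    exact: g0.
  - move=> A mA A0.
    have := g0 k; rewrite -{1}(setTI (g k)) -(setvU A) setIUl integral_setU//.
    + by rewrite A0 adde0.
    + by apply: measurableI => //; exact: measurableC.
    + exact: measurableI.
    + by rewrite -setIUl setvU setTI; exact: measurable_int (gint k).
    + by apply/disj_setPS => x [[nA _] [Ax _]]; exact: nA.
  - move=> F mF tF F0; rewrite setI_bigcupl integral_bigcup.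
    + by apply: eseries0 => i _ _; exact: F0.
    + exact: trivIset_setIr.
    + by move=> i; exact: measurableI.
    + apply: integrableS (gint k) => //; last by apply: bigcup_sub => i _; exact: subIsetr.
      by apply: bigcup_measurable => i _; exact: measurableI.
have aek k : ae_eq mu (g k) (EFin \o phi) (cst 0%E).
  apply: integral_ae_eq => // E Ek mE; rewrite integral0 -[RHS](key k E mE).
  by congr (integral _ _ _); apply/esym/setIidPl.
have := ae_foralln aek; apply: filterS => x /= h _.
have [k _ gkx] : (\bigcup_k g k) x by rewrite gT.
by have [] := h k gkx.
Qed.

Lemma indic_L2 (B : set T) : measurable B -> (mu B < +oo)%E ->
  (fun t => (\1_B t)%:C) \in L2_pred mu.
Proof.
move=> mB fB; apply/andP; split.
  apply: Lfun2_sqr_lty; first exact: measurable_indic.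
  rewrite (_ : \int[mu]_x _ = \int[mu]_x (\1_B x)%:E)%E.
    by rewrite integral_indic// setIT.
  apply: eq_integral => x _ /=; rewrite indicE; congr EFin.
  by case: (_ \in _); rewrite ?expr1n ?expr0n.
have p1 : (1 <= 2%:E :> \bar R)%E by rewrite lee_fin ler1n.
exact: (Lfun_submod_closed mu p1).1.
Qed.

Definition indicL2 (B : set T) (mB : measurable B) (fB : (mu B < +oo)%E) : L2 mu :=
  \pi_(L2 mu) (L2_Fun (indic_L2 mB fB)).

Lemma Lfun2_integrable_finite (B : set T) (phi : T -> R) : measurable B -> (mu B < +oo)%E ->
  phi \in Lfun mu 2%:E -> mu.-integrable B (EFin \o phi).
Proof.
move=> mB fB Lphi; have /andP[LB _] := indic_L2 mB fB.
apply/(integrable_mkcond _ mB).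
have := Lfun2_mul_integrable Lphi LB; apply: eq_integrable => // x _.
by rewrite epatch_indic.
Qed.

Lemma inner_indicL2 (f : L2_fun mu) (B : set T) (mB : measurable B) (fB : (mu B < +oo)%E) :
  inner (\pi_(L2 mu) f) (indicL2 mB fB) = cintegral mu B f.
Proof.
rewrite inner_pi; apply: complex_eqP => /=; rewrite [in RHS]Rintegral_mkcond;
  apply: eq_Rintegral => x _; rewrite patch_indic /= ?cReM ?cImM cReJ cImJ /=;
  by rewrite oppr0 mulr0 ?subr0 ?add0r.
Qed.

Lemma indicators_total (g : nat -> set T) (mg : forall k, measurable (g k))
    (fg : forall k, (mu (g k) < +oo)%E) :
  measurable = <<s range g >> -> setI_closed (range g) -> \bigcup_k g k = setT ->
  total (@inner _ _ _ mu) (fun k => indicL2 (mg k) (fg k)).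
Proof.
move=> gen gI gT; elim/quotW=> f fg0.
have rg0 k : \int[mu]_(x in g k) Re (f x) = 0 /\ \int[mu]_(x in g k) Im (f x) = 0.
  by have := fg0 k; rewrite inner_indicL2 => -[].
have ae0 (phi : T -> R) : phi \in Lfun mu 2%:E ->
    (forall k, \int[mu]_(x in g k) phi x = 0) -> phi = cst 0 %[ae mu].
  move=> Lphi phi0; have iphi k := Lfun2_integrable_finite (mg k) (fg k) Lphi.
  apply: (pi_system_ae0 gen) => // k.
  rewrite -[LHS]fineK; last exact: integrable_fin_num (iphi k).
  by congr EFin; exact: phi0.
have r0 := ae0 _ (L2_fun_Re f) (fun k => (rg0 k).1).
have i0 := ae0 _ (L2_fun_Im f) (fun k => (rg0 k).2).
rewrite -[RHS]/(\pi_(L2 mu) 0); apply: L2_eqP.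
apply: filterS2 r0 i0 => x /= rx ix Dx; apply: complex_eqP; [exact: rx|exact: ix].
Qed.

Lemma inner_indicL2_indicL2 (B C : set T) (mB : measurable B) (fB : (mu B < +oo)%E)
    (mC : measurable C) (fC : (mu C < +oo)%E) :
  inner (indicL2 mB fB) (indicL2 mC fC) = (fine (mu (B `&` C)))%:C.
Proof.
rewrite inner_indicL2; apply: complex_eqP => /=; last first.
  by rewrite /Rintegral integral0.
by rewrite /Rintegral integral_indic.
Qed.

End indicators.

(** * Half-open boxes with rational corners *)

Definition box (R : realType) n (a b : Rn R n) : set (Rn R n) :=
  [set t | forall i, tnth a i < tnth t i <= tnth b i].

Lemma measurable_box (R : realType) n (a b : Rn R n) : measurable (box a b).
Proof.
have -> : box a b = \bigcap_(i in [set: 'I_n]) ((@tnth n R ^~ i) @^-1` `]tnth a i, tnth b i]).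
  apply/seteqP; split => t /= h i; first by move=> _; rewrite /= in_itv/=.
  by have := h i I; rewrite /= in_itv/=.
apply: fin_bigcap_measurable => // i _.
by rewrite -[X in measurable X]setTI; apply: measurable_tnth => //; exact: measurable_itv.
Qed.

Lemma lebesgue_measure_oc (R : realType) (x y : R) :
  lebesgue_measure (`]x, y]%classic : set R) = (Num.max 0 (y - x))%:E.
Proof.
rewrite lebesgue_measure_itv/= lte_fin /Num.max subr_gt0.
by case: ifP => // _; rewrite -EFinB.
Qed.

Lemma lebesgue_n_box (R : realType) n (a b : Rn R n) :
  lebesgue_n R n (box a b) = (\prod_(i < n) Num.max 0 (tnth b i - tnth a i))%:E.
Proof.
elim: n a b => [|n ih] a b.
  rewrite big_ord0 /= /dirac indicE mem_set//=. by case.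
have tbe (x : Rn R n.+1) j : tnth [tuple of behead x] j = tnth x (lift ord0 j).
  by rewrite tnth_behead; congr tnth; apply: val_inj; rewrite /= ?inordK ?ltnS.
rewrite /= /tuple_measure_cons /pushforward.
have -> : @tcons _ (measurableTypeR R) n @^-1` (box a b) =
    `]thead a, thead b] `*` box [tuple of behead a] [tuple of behead b].
  apply/seteqP; split => -[t0 t] /=; rewrite in_itv/=.
    move=> h; split; first exact: (h ord0).
    by move=> j; have := h (lift ord0 j); rewrite /tcons !tnthS !tbe.
  move=> [h0 h] i; case: (unliftP ord0 i) => [j ->|->]; last exact: h0.
  by have := h j; rewrite /tcons !tnthS !tbe.
rewrite product_measure1E//; last exact: measurable_box.
rewrite ih big_ord_recl EFinM; congr (_ * _)%E; first exact: lebesgue_measure_oc.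
by congr EFin; apply: eq_bigr => j _; rewrite !tbe.
Qed.

Lemma lebesgue_n_box_lty (R : realType) n (a b : Rn R n) :
  (lebesgue_n R n (box a b) < +oo)%E.
Proof. by rewrite lebesgue_n_box ltry. Qed.

Definition ratbox (R : realType) n (p : n.-tuple rat * n.-tuple rat) : set (Rn R n) :=
  box [tuple ratr (tnth p.1 i) | i < n] [tuple ratr (tnth p.2 i) | i < n].

Arguments ratbox R {n} p.

(** A number that encodes nothing gives the box with both corners 0, itself a rational box, so the
    range consists exactly of the rational boxes. *)
Definition ratbox_seq (R : realType) n (k : nat) : set (Rn R n) :=
  ratbox R (odflt ([tuple 0 | i < n], [tuple 0 | i < n]) (choice.unpickle k)).

Lemma ratboxE (R : realType) n p (t : Rn R n) :
  ratbox R p t <-> forall i, ratr (tnth p.1 i) < tnth t i <= ratr (tnth p.2 i).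
Proof. by split => h i; have := h i; rewrite !tnth_mktuple. Qed.

Lemma range_ratbox (R : realType) n p : range (@ratbox_seq R n) (ratbox R p).
Proof. by exists (choice.pickle p) => //; rewrite /ratbox_seq choice.pickleK. Qed.

Lemma ratbox_sub (R : realType) n (t : Rn R n) (a : Rn R n) :
  (forall i, tnth a i < tnth t i) ->
  exists2 p, ratbox R p t & forall i, tnth a i < ratr (tnth p.1 i).
Proof.
move=> ta.
have [q hq] := choice (fun i : 'I_n => rat_in_itvoo (ta i)).
have t1 (i : 'I_n) : tnth t i < tnth t i + 1 by rewrite ltrDl.
have [r hr] := choice (fun i : 'I_n => rat_in_itvoo (t1 i)).
exists ([tuple q i | i < n], [tuple r i | i < n]).
  apply/ratboxE => i; rewrite /= !tnth_mktuple.
  by have := hq i; have := hr i; rewrite !in_itv/= => /andP[/ltW -> _] /andP[_ ->].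
by move=> i; have := hq i; rewrite /= tnth_mktuple in_itv/= => /andP[].
Qed.

Lemma ratbox_setI (R : realType) n : setI_closed (range (@ratbox_seq R n)).
Proof.
move=> _ _ [j _ <-] [k _ <-]; rewrite /ratbox_seq.
set p := odflt _ (choice.unpickle j); set q := odflt _ (choice.unpickle k).
pose r := ([tuple Num.max (tnth p.1 i) (tnth q.1 i) | i < n],
           [tuple Num.min (tnth p.2 i) (tnth q.2 i) | i < n]).
suff -> : ratbox R p `&` ratbox R q = ratbox R r by exact: range_ratbox.
apply/seteqP; split => t.
  move=> [/ratboxE pt /ratboxE qt]; apply/ratboxE => i; rewrite !tnth_mktuple.
  have /andP[p1 p2] := pt i; have /andP[q1 q2] := qt i.
  by rewrite /Num.max /Num.min; do 2 case: ifP => _; rewrite ?p1 ?p2 ?q1 ?q2.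
move=> /ratboxE rt; split; apply/ratboxE => i; have := rt i; rewrite !tnth_mktuple;
  move=> /andP[r1 r2]; apply/andP; split.
- by apply: le_lt_trans r1; rewrite ler_rat le_max lexx.
- by apply: le_trans r2 _; rewrite ler_rat ge_min lexx.
- by apply: le_lt_trans r1; rewrite ler_rat le_max lexx orbT.
- by apply: le_trans r2 _; rewrite ler_rat ge_min lexx orbT.
Qed.

Lemma ratbox_cover (R : realType) n : \bigcup_k (@ratbox_seq R n k) = setT.
Proof.
apply/seteqP; split => // t _.
have [p tp _] := @ratbox_sub R n t [tuple tnth t i - 1 | i < n]
  (fun i => ltac:(rewrite tnth_mktuple ltrBlDr ltrDl//)).
by have [k _ kp] := range_ratbox R p; exists k => //; rewrite kp.
Qed.

Lemma sigma_ratbox_union (R : realType) n (A : set (Rn R n)) :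
  (forall t, A t -> exists2 p, ratbox R p t & ratbox R p `<=` A) ->
  <<s range (@ratbox_seq R n) >> A.
Proof.
move=> hA.
have gsa := smallest_sigma_algebra [set: Rn R n] (range (@ratbox_seq R n)).
have -> : A = \bigcup_k (if pselect (@ratbox_seq R n k `<=` A) then @ratbox_seq R n k else set0).
  apply/seteqP; split => t.
    move=> /hA[p tp pA]; have [k _ kp] := range_ratbox R p; exists k => //.
    by case: pselect => //; rewrite kp.
  by move=> [k _]; case: pselect => // kA /kA.
case: gsa => s0 _ sU; apply: sU => k; case: pselect => /= [kA|//].
by apply: sub_sigma_algebra; exists k.
Qed.

Lemma measurable_ratbox (R : realType) n :
  measurable = <<s range (@ratbox_seq R n) >>.
Proof.
apply/seteqP; split => A; last first.
  move: A; apply: smallest_sub; first exact: sigma_algebra_measurable.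
  by move=> _ [k _ <-]; exact: measurable_box.
pose T' := g_sigma_algebraType (range (@ratbox_seq R n)).
have mid : measurable_fun [set: T'] (id : T' -> Rn R n).
  apply/measurable_fun_tnthP => i.
  apply: (measurability _ (RGenOInfty.measurableE R)) => _ [_ [x ->] <-].
  rewrite setTI; apply: sigma_ratbox_union => t; rewrite /= in_itv/= andbT => xt.
  (* The lower corner lies above [x] in coordinate [i], which keeps the box in the half-space; in
     the other coordinates any bound below [t] serves. *)
  have [p tp hp] := @ratbox_sub R n t [tuple if j == i then x else tnth t j - 1 | j < n]
    (fun j => ltac:(rewrite tnth_mktuple; case: eqP => [->//|_]; rewrite ltrBlDr ltrDl//)).
  exists p => // u /ratboxE up /=; rewrite in_itv/= andbT.
  have := hp i; rewrite tnth_mktuple eqxx => /lt_trans; apply.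
  by have /andP[] := up i.
by move=> mA; have := mid measurableT A mA; rewrite setTI preimage_id.
Qed.

Lemma ratbox_total (R : realType) n : exists g, total (@inner _ _ _ (lebesgue_n R n)) g.
Proof.
have mg k : measurable (@ratbox_seq R n k) by exact: measurable_box.
have fg k : (lebesgue_n R n (@ratbox_seq R n k) < +oo)%E by exact: lebesgue_n_box_lty.
exists (fun k => indicL2 (mg k) (fg k)); apply: indicators_total.
- exact: measurable_ratbox.
- exact: ratbox_setI.
- exact: ratbox_cover.
Qed.

(** The unit cubes with first side []j, j+1]] and other sides []0, 1]] are disjoint and of measure
    1. *)
Lemma infinite_orthonormal (R : realType) n :
  exists h, orthonormal (@inner _ _ _ (lebesgue_n R n.+1)) h.
Proof.
pose a (j : nat) : Rn R n.+1 := [tuple if i == ord0 then j%:R else 0 | i < n.+1].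
pose b (j : nat) : Rn R n.+1 := [tuple if i == ord0 then j.+1%:R else 1 | i < n.+1].
exists (fun j => indicL2 (measurable_box (a j) (b j)) (lebesgue_n_box_lty (a j) (b j))).
move=> i j; rewrite inner_indicL2_indicL2; have [->|ij] := eqVneq i j.
  rewrite setIid; have e1 : lebesgue_n R n.+1 (box (a j) (b j)) = 1%E.
    rewrite lebesgue_n_box big1// => k _; rewrite !tnth_mktuple.
    by case: eqP => _; rewrite ?subr0 ?max_r// -natr1 addrAC subrr add0r ?max_r.
  by apply: (congr1 (fun x => (fine x)%:C) e1).
rewrite (_ : _ `&` _ = set0) ?measure0//.
apply/seteqP; split => // t [/(_ ord0) + /(_ ord0)]; rewrite !tnth_mktuple eqxx.
move=> /andP[i1 i2] /andP[j1 j2].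
have := lt_le_trans i1 j2; have := lt_le_trans j1 i2.
rewrite !ltr_nat !ltnS => ji ij'; move: ij; rewrite eqn_leq ji ij'.
by [].
Qed.

(** * Trace and eigenvalues of positive operators *)

Lemma cvg_real_complex (R : realType) (a : nat -> R) (t : R) :
  a @ \oo --> t -> (fun n => (a n)%:C : R[i]^o) @ \oo --> (t%:C : R[i]^o).
Proof.
move=> at_; apply/cvgrPdist_lt => eps; rewrite ltcE/= => /andP[/eqP eps_im eps_re].
have [N _ hN] := (cvgrPdist_lt _ _).1 at_ _ eps_re.
exists N => // n /hN /= h; rewrite -rmorphB/= normc_def/= expr0n/= addr0 sqrtr_sqr.
by rewrite ltcE/= eps_im eqxx.
Qed.

Lemma cvg_complex_Re (R : realType) (u : nat -> R[i]) (t : R[i]) :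
  (u : nat -> R[i]^o) @ \oo --> (t : R[i]^o) -> (fun n => Re (u n)) @ \oo --> Re t.
Proof.
move=> ut; apply/cvgrPdist_lt => eps eps0.
have epsC : 0 < eps%:C :> R[i] by rewrite ltcR.
have [N _ hN] := (cvgrPdist_lt _ _).1 ut _ epsC.
exists N => // n /hN /= h; rewrite -ltcR; apply: le_lt_trans h.
by rewrite -cReN -cReD; exact: normc_ge_Re.
Qed.

Lemma nneseries_series (R : realType) (a : nat -> R) (t : R) : (forall n, 0 <= a n) ->
  series a @ \oo --> t <-> (\sum_(0 <= n <oo) (a n)%:E = t%:E)%E.
Proof.
move=> a0.
have sE : (fun n => \sum_(0 <= k < n) (a k)%:E)%E = EFin \o series a.
  by apply/funext => n /=; rewrite sumEFin.
split => [at_|sum_a].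
  apply/cvg_lim => //; rewrite sE; apply: cvg_EFin; first exact: nearW.
  exact: at_.
have : (fun n => \sum_(0 <= k < n) (a k)%:E)%E @ \oo --> t%:E.
  by rewrite -sum_a; apply: is_cvg_nneseries => n _ _; rewrite lee_fin.
by rewrite sE => /fine_cvg.
Qed.

Section positive_operators.
Context d (T : measurableType d) (R : realType) (mu : {measure set T -> \bar R}).
Local Notation H := (L2 mu).
Local Notation HH := (inner_hilbert mu).

Lemma inner_real (A : H -> H) u : positive_operator A ->
  inner (A u) u = (Re (inner (A u) u))%:C.
Proof.
by move=> A0; apply: complex_eqP => //=; have := A0 u; rewrite lecE/= => /andP[/eqP].
Qed.

Lemma positive_Re (A : H -> H) u : positive_operator A -> 0 <= Re (inner (A u) u).
Proof. by move=> A0; have := A0 u; rewrite lecE/= => /andP[_]. Qed.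

Lemma positive_symmetric (A : H -> H) : linear A -> positive_operator A ->
  forall u v, inner (A u) v = inner u (A v).
Proof.
move=> linA A0; apply: (real_diag_symmetric HH linA) => u.
by rewrite inner_real.
Qed.

Lemma positive_absolute_value (A : H -> H) : bounded_operator A -> positive_operator A ->
  is_absolute_value A A.
Proof.
move=> bA A0; split => //; rewrite adjoint_symmetric//.
exact: positive_symmetric bA.1 A0.
Qed.

Lemma series_inner_Re (A : H -> H) (e : nat -> H) : positive_operator A ->
  series (fun n => inner (A (e n)) (e n) : R[i]^o) =
  (fun n => (series (fun n => Re (inner (A (e n)) (e n))) n)%:C).
Proof.
move=> A0; apply/funext => n; rewrite /series/= rmorph_sum/=.
by apply: eq_bigr => k _; rewrite -inner_real.
Qed.

Lemma positive_trace_series (A : H -> H) (e : nat -> H) (t : R) : positive_operator A ->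
  series (fun n => inner (A (e n)) (e n) : R[i]^o) @ \oo --> (t%:C : R[i]^o) <->
  (\sum_(0 <= n <oo) (Re (inner (A (e n)) (e n)))%:E = t%:E)%E.
Proof.
move=> A0; rewrite -nneseries_series; last by move=> n; exact: positive_Re.
rewrite series_inner_Re//; split; last exact: cvg_real_complex.
by move=> /cvg_complex_Re.
Qed.

(** A positive [A] is its own absolute value, so the trace class condition and the trace concern the
    same nonnegative series. *)
Lemma positive_has_trace (A : H -> H) (t : R) : bounded_operator A -> positive_operator A ->
  (forall e, orthonormal_basis e ->
    (\sum_(0 <= n <oo) (Re (inner (A (e n)) (e n)))%:E = t%:E)%E) ->
  has_trace A t%:C.
Proof.
move=> bA A0 At; split; last by move=> e /At /(positive_trace_series _ _ A0).
split => //; exists A; split; first exact: positive_absolute_value.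
by move=> e /At ->; rewrite ltry.
Qed.

Lemma positive_eigenvalue_sum (A : H -> H) (t : R) (N : option nat) (l : nat -> R[i]) :
  (exists e : nat -> H, orthonormal_basis e) ->
  positive_operator A -> has_trace A t%:C -> lists_eigenvalues A N l ->
  series (fun i => (if i \in index_set N then l i else 0) : R[i]^o) @ \oo --> (t%:C : R[i]^o).
Proof.
move=> [e be] A0 [[bA _] trA] lists.
(* Padding with 0 turns the list into a full sequence without changing how often a nonzero [z]
   occurs; the two conventions for the eigenvalue 0 differ only at [z = 0]. *)
set l' := fun i => (if i \in index_set N then l i else 0) : R[i].
have [M AM] := bounded_form bA.
have [oe te] := be.
have tre : series (fun n => Re (inner (A (e n)) (e n))) @ \oo --> t.
  have /(positive_trace_series _ _ A0) := trA e be.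
  by rewrite -nneseries_series// => n; exact: positive_Re.
have mult z : z != 0 -> counting [set i | l' i = z] = algebraic_multiplicity A z.
  move=> z0; rewrite -[RHS](_ : counting (index_set N `&` [set i | l i = z]) = _); last first.
    have [//|[zz _]] := lists z; by rewrite zz eqxx in z0.
  congr counting; apply/seteqP; split => i /=; rewrite /l'.
    case: ifPn => [|_ zz]; first by rewrite inE.
    by rewrite -zz eqxx in z0.
  by move=> [iN liz]; rewrite mem_set.
have [Iml' l't] := eigenvalue_series HH bA.1 (positive_symmetric bA.1 A0)
  (fun u => positive_Re u A0) AM oe te tre mult.
have -> : series (l' : nat -> R[i]^o) = (fun n => (series (fun i => Re (l' i)) n)%:C).
  apply/funext => n; rewrite /series/= rmorph_sum/=.
  by apply: eq_bigr => k _; apply: complex_eqP => //=.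
exact: cvg_real_complex.
Qed.

End positive_operators.

(** For [n = 0] the space is one-dimensional and has no orthonormal family indexed by [nat]. *)
Lemma lebesgue_n_orthonormal_basis (R : realType) n : (0 < n)%N ->
  exists e : nat -> L2 (lebesgue_n R n), orthonormal_basis e.
Proof.
case: n => // n _; have [g gt] := ratbox_total R n.+1.
have [h oh] := infinite_orthonormal R n.
have [e oe te] := gram_schmidt (inner_hilbert _) gt oh.
by exists e.
Qed.

(** [q psi z] stands for the diagonal form of [alpha z S] at [psi]. The terms being nonnegative, the
    sum over the basis passes under the integral and becomes the indicator of [Omega]. An arbitrary
    measure space replaces the completed phase space. *)
Lemma averaged_trace d d' (T : measurableType d) (Z : measurableType d') (R : realType)
    (mu : {measure set T -> \bar R}) (nu : {measure set Z -> \bar R})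
    (Omega : set Z) (q : L2 mu -> Z -> R) (K : L2 mu -> L2 mu) :
  measurable Omega -> (nu Omega < +oo)%E -> (forall psi z, 0 <= q psi z) ->
  (forall e z, orthonormal_basis e -> (\sum_(0 <= n <oo) (q (e n) z)%:E = 1)%E) ->
  bounded_operator K ->
  (forall psi, let g z := (\1_Omega z)%:C * (q psi z)%:C in
    cintegrable nu setT g /\ inner (K psi) psi = cintegral nu setT g) ->
  positive_operator K /\ has_trace K (fine (nu Omega))%:C.
Proof.
move=> mO fO q0 q1 bK Kq.
pose g psi z := \1_Omega z * q psi z.
have g0 psi z : 0 <= g psi z by rewrite mulr_ge0// indicE.
have gE psi z : (\1_Omega z)%:C * (q psi z)%:C = (g psi z)%:C by rewrite -rmorphM.
have gint psi : nu.-integrable setT (EFin \o g psi).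
  have [[+ _] _] := Kq psi; apply: eq_integrable => // z _.
  by rewrite gE.
have Kg psi : inner (K psi) psi = (\int[nu]_z g psi z)%:C.
  have [_ ->] := Kq psi.
  transitivity (cintegral nu setT (fun z => (g psi z)%:C)).
    by congr cintegral; apply/funext => z; exact: gE.
  by apply: complex_eqP => //=; rewrite /Rintegral integral0.
have K0 : positive_operator K.
  move=> psi; rewrite Kg ler0c; apply: Rintegral_ge0 => z _; exact: g0.
have KE psi : ((Re (inner (K psi) psi))%:E = \int[nu]_z (g psi z)%:E)%E.
  by rewrite Kg /= /Rintegral fineK//; exact: (integrable_fin_num measurableT (gint psi)).
split => //; apply: positive_has_trace => // e be.
under eq_eseriesr do rewrite KE.
rewrite -integral_nneseries//.
- rewrite (_ : \int[_]_z _ = \int[nu]_z (\1_Omega z)%:E)%E.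
    by rewrite integral_indic// setIT fineK// ge0_fin_numE.
  apply: eq_integral => z _.
  rewrite (eq_eseriesr (g := fun k => (\1_Omega z)%:E * (q (e k) z)%:E)%E); last first.
    by move=> k _; rewrite -EFinM.
  by rewrite nneseriesZl ?q1 ?mule1// => k _; rewrite lee_fin.
- by move=> n; exact: measurable_int (gint (e n)).
- by move=> n z _; rewrite lee_fin.
Qed.

Lemma inner_alpha (R : realType) d (z : Rn R d * Rn R d)
    (S : L2 (lebesgue_n R d) -> L2 (lebesgue_n R d)) psi phi :
  inner (alpha z S psi) phi =
  inner (S (adjoint (tf_shift z) psi)) (adjoint (tf_shift z) phi).
Proof.
exact: (unitary_adjoint (tf_shift_isometry z) (tf_shift_surjective z)).
Qed.

Theorem proposition6p1 (R : realType) (d : nat) (hd : (0 < d)%N)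
    (Omega : set (phase_space R d))
    (S : L2 (lebesgue_n R d) -> L2 (lebesgue_n R d))
    (K : L2 (lebesgue_n R d) -> L2 (lebesgue_n R d)) :
  measurable Omega -> (phase_measure Omega < +oo)%E ->
  positive_operator S -> has_trace S 1 ->
  is_convolution (fun z => (\1_Omega z)%:C) S K ->
  has_trace K (fine (phase_measure Omega))%:C /\
  (forall (N : option nat) (l : nat -> R[i]),
    lists_eigenvalues K N l ->
    series (fun i => (if i \in index_set N then l i else 0) : R[i]^o) @ \oo -->
      ((fine (phase_measure Omega))%:C : R[i]^o)).
Proof.
move=> mO fO S0 [_ trS] [bK Kconv].
pose q (psi : L2 (lebesgue_n R d)) (z : phase_space R d) :=
  Re (inner (S (adjoint (tf_shift z) psi)) (adjoint (tf_shift z) psi)).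
have [K0 trK] : positive_operator K /\ has_trace K (fine (phase_measure Omega))%:C.
  apply: (averaged_trace (q := q)) mO fO _ _ bK _ => [psi z|e z be|psi].
  - exact: positive_Re.
  - have bz := orthonormal_basis_adjoint (tf_shift_isometry z) (tf_shift_surjective z) be.
    by have /(positive_trace_series _ _ S0) := trS _ bz.
  - have -> : (fun z => (\1_Omega z)%:C * (q psi z)%:C) =
        (fun z => (\1_Omega z)%:C * inner (alpha z S psi) psi).
      by apply/funext => z; rewrite inner_alpha [in RHS]inner_real.
    exact: Kconv.
split => // N l; apply: positive_eigenvalue_sum => //.
exact: lebesgue_n_orthonormal_basis.
Qed.
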